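(* There is an absolute constant $C_0\ge 3\times 10^3$ such that the following holds. Let $k\ge 2$ and $r\ge 0$ be integers, let $n\ge C_0(r+1)^3(k+r)k^2$, and let $\delta\in\left[\frac{150k^3(r+1)^2}{n},\,1-\frac{150k^3(r+1)^3}{n}\right]\cup\{1\}$. If $\mathcal F\subseteq\binom{[n]}{k}$ satisfies $$|\mathcal F|=\sum_{i=1}^{r}\binom{n-i}{k-1}+\delta\binom{n-(r+1)}{k-1}$$ and $\mathcal I(\mathcal F)=\mathcal{MI}(\mathcal F)$, then, up to isomorphism, $\mathcal L^{(r)}_{n,k,1}\subseteq\mathcal F\subseteq\mathcal L^{(r+1)}_{n,k,1}$.
   Context: $[n]=\{1,\dots,n\}$ and $\binom{[n]}{k}$ is the family of all $k$-element subsets of $[n]$. For $\mathcal F\subseteq\binom{[n]}{k}$ and $x\in[n]$, $\mathcal F(x)=\{F\in\mathcal F: x\in F\}$. The total intersection is $\mathcal I(\mathcal F)=\sum_{A\in\mathcal F}\sum_{B\in\mathcal F}|A\cap B|=\sum_{x\in[n]}|\mathcal F(x)|^2$ (sum over ordered pairs, including $A=B$), and $\mathcal{MI}(\mathcal F)=\max\{\mathcal I(\mathcal G):\mathcal G\subseteq\binom{[n]}{k},\ |\mathcal G|=|\mathcal F|\}$. Lexicographic order on $\binom{[n]}{k}$: $F_1$ precedes $F_2$ if the minimum element of the symmetric difference $F_1\triangle F_2$ lies in $F_1$. For $t\ge1$, $r\ge 0$, $\mathcal L^{(r)}_{n,k,t}$ denotes the family of the first $\binom{n-t+1}{k-t+1}-\binom{n-(t+r-1)}{k-t+1}$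 $k$-subsets of $[n]$ in lexicographic order. ''Up to isomorphism'' means after applying some permutation of $[n]$ to all sets of $\mathcal F$. The size condition implicitly requires $|\mathcal F|$ to be an integer. *)

(* Defs.v *)
(* Ground set [n] is modelled by 'I_n = {0,...,n-1}
   (order-preserving relabelling i+1 |-> i). *)
From HB Require Import structures.
From mathcomp Require Import all_boot all_order all_algebra fingroup perm.
From mathcomp Require Import reals.
Set Implicit Arguments. Unset Strict Implicit. Unset Printing Implicit Defensive.

Definition ksets (n k : nat) : {set {set 'I_n}} := [set A : {set 'I_n} | #|A| == k].

Definition total_inter n (F : {set {set 'I_n}}) : nat :=
  \sum_(A in F) \sum_(B in F) #|A :&: B|.

Definition max_total_inter n k (F : {set {set 'I_n}}) : nat :=
  \max_(G : {set {set 'I_n}} | (G \subset ksets n k) && (#|G| == #|F|)) total_inter G.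

Definition lex_lt n (A B : {set 'I_n}) : bool :=
  [exists x : 'I_n, [&& x \in A, x \notin B &
     [forall y : 'I_n, (val y < val x)%N ==> ((y \in A) == (y \in B))]]].

Definition lex_initial n k (m : nat) : {set {set 'I_n}} :=
  [set A in ksets n k | (#|[set B in ksets n k | lex_lt B A]| < m)%N].

Definition Lex n k t r : {set {set 'I_n}} :=
  lex_initial n k ('C(n - t + 1, k - t + 1) - 'C(n - (t + r - 1), k - t + 1)).

Definition perm_family n (s : {perm 'I_n}) (F : {set {set 'I_n}}) : {set {set 'I_n}} :=
  [set [set s x | x in A] | A : {set 'I_n} in F].

(* Main.v *)
(* Write d(x) for the number of members of F through x, so that the total
   intersection is the sum of the d(x)^2, and w(A) for the sum of d over A.
   Exchanging A in F for B outside F shows that an optimal F is a strict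
   threshold family: w(B) < w(A).
   Let D = C(n-1,k-1), let S consist of the r points of largest degree and v be
   the next one.  Comparison with the lexicographic family bounds the sum of
   the d(x)^2 from below, while inclusion-exclusion to second order bounds the
   sum of d over few points by |F| plus a small error; hence d is about D on S,
   about delta D at v, and small elsewhere.
   If delta <= 1/2, the threshold property forces F to contain all sets hitting
   S; the remaining sets form an optimal family on the complement of S with
   r = 0, and the same analysis at the scale |F| puts them in the star of v.
   If delta >= 1/2, the threshold property puts F inside the family of sets
   hitting S or v; the family missing from it turns out to lie essentially in
   the star of v, and one more exchange shows that it avoids S. *)
Require Import Defs.
From HB Require Import structures.
From mathcomp Require Import all_boot all_order all_algebra fingroup perm.
From mathcomp Require Import reals ring lra zify.
Import Order.TTheory GRing.Theory Num.Theory.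
Local Open Scope ring_scope.
Set Implicit Arguments. Unset Strict Implicit. Unset Printing Implicit Defensive.

(** * Degrees in families of k-sets *)

Section Families.
Local Open Scope nat_scope.
Variable T : finType.
Implicit Types (F G : {set {set T}}) (A B S V X Y : {set T}) (x y v : T).

(** The ground set is a subset [V] of a fixed type, so that deleting the points of [S] changes [V]
    alone. *)
Definition ksub V k : {set {set T}} := [set A : {set T} | A \subset V & #|A| == k].

Definition deg F x : nat := #|[set A in F | x \in A]|.

Definition wt F A : nat := \sum_(x in A) deg F x.

Definition inter F : nat := \sum_x deg F x ^ 2.

Definition meet F S : {set {set T}} := [set A in F | A :&: S != set0].

Definition optimal V k F : Prop :=
  F \subset ksub V k /\
  forall G, G \subset ksub V k -> #|G| = #|F| -> inter G <= inter F.

Lemma degE F x : deg F x = \sum_(A in F) (x \in A).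
Proof.
rewrite /deg -sum1_card [RHS](bigID (fun A => x \in A)) /= [X in _ + X]big1 ?addn0.
  rewrite (eq_bigl (fun A => (A \in F) && (x \in A))) => [|A]; last by rewrite inE.
  by apply: eq_bigr => A /andP[_ ->].
by move=> A /andP[_ /negbTE ->].
Qed.

Lemma sum_deg_mul F (f : T -> nat) :
  \sum_x f x * deg F x = \sum_(A in F) \sum_(x in A) f x.
Proof.
under eq_bigr => x _ do rewrite degE big_distrr /=.
rewrite exchange_big /=; apply: eq_bigr => A _.
rewrite [RHS]big_mkcond /=; apply: eq_bigr => x _.
by case: (x \in A); rewrite ?muln1 ?muln0.
Qed.

Lemma sum_deg_on F X : \sum_(x in X) deg F x = \sum_(A in F) #|A :&: X|.
Proof.
have := sum_deg_mul F (fun x => (x \in X) : nat).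
rewrite [LHS](_ : _ = \sum_(x in X) deg F x) => [->|].
  apply: eq_bigr => A _; rewrite -sum1_card [RHS]big_mkcond [LHS]big_mkcond /=.
  by apply: eq_bigr => x _; rewrite inE; case: (x \in A); case: (x \in X).
by rewrite [RHS]big_mkcond; apply: eq_bigr => x _; case: (x \in X); rewrite ?mul1n ?mul0n.
Qed.

Lemma sum_deg V k F : F \subset ksub V k -> \sum_x deg F x = k * #|F|.
Proof.
move=> sF; transitivity (\sum_(x in [set: T]) deg F x).
  by apply: eq_bigl => x; rewrite inE.
rewrite sum_deg_on mulnC -sum_nat_const; apply: eq_bigr => A AF.
by have := subsetP sF _ AF; rewrite inE setIT => /andP[_ /eqP].
Qed.

Lemma inter_wt F : inter F = \sum_(A in F) wt F A.
Proof.
by rewrite -sum_deg_mul; apply: eq_bigr => x _; rewrite expnS expn1.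
Qed.

Lemma deg_le_card F x : deg F x <= #|F|.
Proof. by apply: subset_leq_card; apply/subsetP => A; rewrite inE => /andP[]. Qed.

Lemma degU F G x : [disjoint F & G] -> deg (F :|: G) x = deg F x + deg G x.
Proof.
move=> dFG; rewrite !degE -bigU //=; apply: eq_bigl => A.
by rewrite !inE.
Qed.

Lemma deg_notin V k F x : F \subset ksub V k -> x \notin V -> deg F x = 0.
Proof.
move=> sF xV; rewrite degE big1 // => A /(subsetP sF); rewrite inE => /andP[/subsetP sA _].
by apply/eqP; rewrite eqb0; apply: contra xV => /sA.
Qed.

Lemma card_ksub V k : #|ksub V k| = 'C(#|V|, k).
Proof. exact: cards_draws. Qed.

(** Deleting [Y] is a bijection onto the sets of size [k - #|Y|] in [V :\: Y]. *)
Lemma card_ksub_above V k Y : Y \subset V -> #|Y| <= k ->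
  #|[set A in ksub V k | Y \subset A]| = 'C(#|V| - #|Y|, k - #|Y|).
Proof.
move=> sYV Yk; rewrite -(cardsDS sYV) -card_ksub.
rewrite -(card_in_imset (f := fun A => A :\: Y)); last first.
  move=> A B; rewrite !inE => /andP[_ sA] /andP[_ sB] eAB.
  by rewrite -(setID A Y) -(setID B Y) eAB (setIidPr sA) (setIidPr sB).
congr #|pred_of_set _|; apply/setP => B; apply/imsetP/idP => [[A]|].
  rewrite !inE => /andP[/andP[sA /eqP cA] sY] ->.
  by rewrite setSD //= cardsDS // cA.
rewrite inE subsetD => /andP[/andP[sB dB] /eqP cB].
exists (B :|: Y); last first.
  by rewrite setDUl setDv setU0; apply/esym/setDidPl.
rewrite !inE subUset sB sYV subsetUr andbT /= cardsU.
by move: dB; rewrite -setI_eq0 => /eqP ->; rewrite cards0 cB subn0 subnK.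
Qed.

Lemma card_above_le V k F Y : F \subset ksub V k -> #|Y| <= k ->
  #|[set A in F | Y \subset A]| <= 'C(#|V| - #|Y|, k - #|Y|).
Proof.
move=> /subsetP sF Yk; have [sYV|nYV] := boolP (Y \subset V).
  rewrite -card_ksub_above //; apply: subset_leq_card; apply/subsetP => A.
  by rewrite !inE => /andP[/sF]; rewrite inE => -> ->.
rewrite (_ : [set A in F | _] = set0) ?cards0 //.
apply/setP => A; rewrite !inE; apply/negP => /andP[/sF]; rewrite inE => /andP[sA _] sYA.
by case/negP: nYV; apply: subset_trans sA.
Qed.

Lemma deg_ksub V k x : x \in V -> 0 < k -> deg (ksub V k) x = 'C(#|V| - 1, k - 1).
Proof.
move=> xV k0; rewrite -(cards1 x) -card_ksub_above ?cards1 ?sub1set //.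
by apply: eq_card => A; rewrite !inE sub1set.
Qed.

Lemma deg_le V k F x : F \subset ksub V k -> 0 < k -> deg F x <= 'C(#|V| - 1, k - 1).
Proof.
move=> sF k0; rewrite -(cards1 x); apply: leq_trans (card_above_le sF _); last by rewrite cards1.
by rewrite leq_eqVlt; apply/orP; left; apply/eqP/eq_card => A; rewrite !inE sub1set.
Qed.

Lemma codeg_le V k F x y : F \subset ksub V k -> 1 < k -> x != y ->
  #|[set A in F | (x \in A) && (y \in A)]| <= 'C(#|V| - 2, k - 2).
Proof.
move=> sF k1 xy; have c2 : #|[set x; y]| = 2 by rewrite cards2 xy.
rewrite -c2; apply: leq_trans (card_above_le sF _); last by rewrite c2.
rewrite leq_eqVlt; apply/orP; left; apply/eqP/eq_card => A.
by rewrite !inE subUset !sub1set.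
Qed.

Lemma meetE F S A : (A \in meet F S) = (A \in F) && (A :&: S != set0).
Proof. by rewrite inE. Qed.

Lemma meet_sub F S : meet F S \subset F.
Proof. by apply/subsetP => A; rewrite inE => /andP[]. Qed.

Lemma ksub_diff V k S :
  ksub V k :\: meet (ksub V k) S = ksub (V :\: S) k.
Proof.
apply/setP => A; rewrite !inE subsetD -setI_eq0.
by case: (A \subset V); case: (#|A| == k); case: (_ == _).
Qed.

Lemma card_meet V k S : S \subset V ->
  #|meet (ksub V k) S| + 'C(#|V| - #|S|, k) = 'C(#|V|, k).
Proof.
move=> sSV; rewrite -(cardsDS sSV) -!card_ksub -ksub_diff.
by rewrite cardsDS ?meet_sub // subnKC ?subset_leq_card ?meet_sub.
Qed.

(** The k-sets through [x] split into those hitting [S] and those inside [V :\: S]; the latter exist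
    only for [x] outside [S]. *)
Lemma deg_meet V k S x : S \subset V -> x \in V -> 0 < k ->
  deg (meet (ksub V k) S) x + (x \notin S) * 'C(#|V| - #|S| - 1, k - 1)
  = 'C(#|V| - 1, k - 1).
Proof.
move=> sSV xV k0; rewrite -(deg_ksub xV k0) -(cardsDS sSV).
have -> : ksub V k = meet (ksub V k) S :|: ksub (V :\: S) k.
  by rewrite -ksub_diff setUC -{2}(setIidPr (meet_sub (ksub V k) S)) setUC setID.
rewrite degU; last first.
  by rewrite -ksub_diff -setI_eq0 setIDA setIC setDIl setDv setI0.
rewrite -{2}ksub_diff (_ : meet (meet _ _ :|: _) S = meet (ksub V k) S); last first.
  by apply/setP => A; rewrite !inE subsetD -setI_eq0; case: (_ \subset _); case: (_ == k); case: (_ == _).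
rewrite (_ : _ :\: _ = ksub (V :\: S) k); last first.
  by apply/setP => A; rewrite !inE subsetD -setI_eq0; case: (_ \subset _); case: (_ == k); case: (_ == _).
congr (_ + _); have [xS|xS] := boolP (x \in S); rewrite ?mul0n ?mul1n.
  by rewrite (@deg_notin (V :\: S) k) // inE xS.
by rewrite deg_ksub // inE xS.
Qed.

(* A set meeting [X] in [j] points is counted [j <= 1 + 'C(j, 2)] times. *)
Lemma bonferroni V k F X : F \subset ksub V k -> 1 < k ->
  \sum_(x in X) deg F x <= #|F| + 'C(#|X|, 2) * 'C(#|V| - 2, k - 2).
Proof.
move=> sF k1; rewrite sum_deg_on.
apply: (@leq_trans (\sum_(A in F) (1 + 'C(#|A :&: X|, 2)))).
  by apply: leq_sum => A _; case: #|_| => [//|m]; rewrite binS bin1 addnA addnAC; lia.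
rewrite big_split /= sum1_card leq_add2l.
rewrite -card_ksub -sum_nat_const.
under eq_bigr => A _ do rewrite -card_ksub -sum1_card.
(* Double counting: each pair [Y] inside [X] is charged to the members of [F] above it, at most a
   codegree. *)
rewrite (exchange_big_dep (mem (ksub X 2))) /=; last first.
  by move=> A Y _; rewrite !inE subsetI => /andP[/andP[_ ->] ->].
apply: leq_sum => Y; rewrite inE => /andP[sYX /eqP cY].
rewrite sum1dep_card -{2}cY -{2}cY.
apply: leq_trans (card_above_le sF _); last by rewrite cY.
apply: subset_leq_card; apply/subsetP => A.
by rewrite !inE subsetI => /and3P[-> /andP[-> _] _].
Qed.

(** Union bound: every member through [x] also passes through some other point of [X], so codegrees
    with the points of [X] cover the degree. *)
Lemma deg_le_cover V k F X x : F \subset ksub V k -> 1 < k ->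
  (forall A, A \in F -> x \in A -> exists2 y, y \in X :\ x & y \in A) ->
  deg F x <= #|X| * 'C(#|V| - 2, k - 2).
Proof.
move=> sF k1 hX.
apply: (@leq_trans (\sum_(y in X :\ x) #|[set A in F | (x \in A) && (y \in A)]|)).
  apply: (@leq_trans #|\bigcup_(y in X :\ x) [set A in F | (x \in A) && (y \in A)]|).
    apply: subset_leq_card; apply/subsetP => A; rewrite inE => /andP[AF xA].
    have [y yX yA] := hX A AF xA; apply/bigcupP; exists y => //.
    by rewrite inE AF xA yA.
  elim/big_ind2: _ => [|m E l G h1 h2|//]; first by rewrite cards0.
  by apply: leq_trans (leq_card_setU _ _) _; apply: leq_add.
apply: (@leq_trans (\sum_(y in X :\ x) 'C(#|V| - 2, k - 2))).
  by apply: leq_sum => y; rewrite !inE => /andP[yx _]; apply: codeg_le; rewrite // eq_sym.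
by rewrite sum_nat_const leq_mul2r subset_leq_card ?subsetDl // orbT.
Qed.

(** Exchanging [A] for [B] changes the sum of squares by 2 (w(B) - w(A)) plus the size of the
    symmetric difference. That last term is positive, which makes the inequality strict. *)
Lemma swap_lt V k F A B : optimal V k F -> A \in F -> B \in ksub V k -> B \notin F ->
  wt F B < wt F A.
Proof.
move=> [sF opt] AF BV BF; pose G := B |: (F :\ A).
have cG : #|G| = #|F| by rewrite cardsU1 !inE negb_and BF orbT (cardsD1 A F) AF.
have sG : G \subset ksub V k.
  by rewrite subUset sub1set BV (subset_trans _ sF) // subsetDl.
have degG x : deg G x + (x \in A) = deg F x + (x \in B).
  rewrite !degE (big_setD1 A AF) /= big_setU1 ?inE ?negb_and ?BF ?orbT //=.
  by rewrite [in RHS]addnC addnA addnAC -addnA addnC [X in X + _]addnC.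
have := opt G sG cG; rewrite leqNgt => /negP h; rewrite ltnNge; apply/negP => le_AB.
apply: h.
have AB : A != B by apply: contraNneq BF => <-.
have [z hz] : exists z, (z \in A) != (z \in B).
  apply/existsP; apply: contraR AB => /existsPn h; apply/eqP/setP => z.
  by have := h z; rewrite negbK => /eqP.
have sw (E : {set T}) : 2 * wt F E = \sum_x 2 * (deg F x * (x \in E)).
  rewrite -big_distrr /=; congr (_ * _); rewrite /wt [LHS]big_mkcond /=.
  by apply: eq_bigr => x _; case: (_ \in _); rewrite ?muln1 ?muln0.
have key : inter F + 2 * wt F B < inter G + 2 * wt F A.
  rewrite !sw /inter -!big_split /= (bigD1 z) //= [X in _ < X](bigD1 z) //=.
  rewrite -addSn; apply: leq_add; first by have := degG z; case: (z \in A) hz; case: (z \in B) => //= _; nia.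
  by apply: leq_sum => x _; have := degG x; case: (x \in A); case: (x \in B); nia.
rewrite -(ltn_add2r (2 * wt F A)); apply: leq_ltn_trans key; rewrite leq_add2l leq_mul2l.
by [].
Qed.

End Families.

(** * Concentration of the degrees *)

Section Estimates.
Variables (R : realFieldType) (T : finType).
Implicit Types (F G : {set {set T}}) (A B H S V X Y : {set T}) (x y v : T).

Lemma subset_of_card X (j : nat) : (j <= #|X|)%N -> exists2 Y : {set T}, Y \subset X & #|Y| = j.
Proof.
move=> jX; have /card_gt0P[Y] : (0 < #|ksub X j|)%N by rewrite card_ksub bin_gt0.
by rewrite inE => /andP[sYX /eqP]; exists Y.
Qed.

Lemma bin2_le (j : nat) : ('C(j, 2))%:R <= j%:R ^+ 2 / 2 :> R.
Proof.
rewrite ler_pdivlMr ?ltr0n // -natrX -natrM ler_nat.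
by have := mul_bin_diag j 1; case: j => [//|j] /=; rewrite bin1; nia.
Qed.

(** Otherwise take the least j with j theta > 2 |F|, and j points of [X]. Minimality and theta <=
    |F| give j theta <= 3 |F|, while [bonferroni] gives |F| < (j^2 / 2) p, with p the codegree
    bound. Multiplying by theta^2 contradicts the last hypothesis. *)
Lemma few_large V k F X (theta : R) : F \subset ksub V k -> (1 < k)%N -> 0 < theta ->
  (forall x, x \in X -> theta <= (deg F x)%:R) ->
  9 * #|F|%:R * ('C(#|V| - 2, k - 2))%:R <= 2 * theta ^+ 2 ->
  #|X|%:R * theta <= 2 * #|F|%:R.
Proof.
move=> sF k1 t0 hX small; rewrite leNgt; apply/negP => bad.
have /ex_minnP[j hj jmin] : exists j : nat, 2 * #|F|%:R < j%:R * theta by exists #|X|.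
have [Y sYX cY] := subset_of_card (jmin _ bad).
have j0 : (0 < j)%N by case: j hj {jmin cY} => //; rewrite mul0r ltNge mulr_ge0.
have jm1 : (j%:R - 1) * theta <= 2 * #|F|%:R.
  rewrite leNgt; apply/negP; rewrite -[1]/(1%:R) -natrB // => /jmin; lia.
have tm : theta <= #|F|%:R.
  have /card_gt0P[x xY] : (0 < #|Y|)%N by rewrite cY.
  by apply: le_trans (hX x (subsetP sYX _ xY)) _; rewrite ler_nat deg_le_card.
have := bonferroni Y sF k1; rewrite -(ler_nat R) natrD natrM cY natr_sum => bf.
have lo : j%:R * theta <= \sum_(x in Y) (deg F x)%:R.
  rewrite -cY mulrC mulr_natr -sumr_const; apply: ler_sum => x xY.
  by apply: hX; apply: subsetP xY.
have b2 := bin2_le j.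
move: small bf lo b2 jm1 tm hj t0.
have p0 : 0 <= ('C(#|V| - 2, k - 2))%:R :> R by [].
have m0 : 0 <= #|F|%:R :> R by [].
move: ('C(_ - 2, _))%:R p0 ('C(j, 2))%:R (\sum_(x in Y) _) (#|F|%:R) m0 (j%:R : R) => p p0 b s m m0 J.
move=> small bf lo b2 jm1 tm hj t0.
have h1 : J * theta <= m + J ^+ 2 / 2 * p.
  by apply: le_trans lo _; apply: le_trans bf _; rewrite lerD2l ler_wpM2r.
have h2 : (J * theta) ^+ 2 <= (3 * m) ^+ 2.
  by rewrite lerXn2r ?nnegrE //; nra.
have h3 : m * theta ^+ 2 < J ^+ 2 / 2 * p * theta ^+ 2.
  by rewrite ltr_pM2r ?exprn_gt0 //; lra.
have h4 : (J * theta) ^+ 2 * p <= (3 * m) ^+ 2 * p by rewrite ler_wpM2r.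
have h5 : m * (9 * m * p) <= m * (2 * theta ^+ 2) by rewrite ler_wpM2l.
by move: h3 h4 h5; rewrite !exprMn; lra.
Qed.

(* Sets of [F] missing [S] carry more degree than [a U], hence hit [H] twice;
   then every degree outside [S] is a sum of few codegrees, a contradiction. *)
Lemma meet_dichotomy V k F S H (U a b : R) :
  optimal V k F -> (1 < k)%N ->
  (forall x, x \in S -> a * U <= (deg F x)%:R) ->
  (forall x, x \notin S -> (deg F x)%:R <= b * U) ->
  (forall x, x \notin H -> (deg F x)%:R <= U / (4 * k%:R)) ->
  0 <= U -> b + 1 / 4 <= a ->
  k%:R * ((#|S| + #|H|)%N%:R * ('C(#|V| - 2, k - 2))%:R) <= a * U ->
  meet (ksub V k) S \subset F \/ F \subset meet (ksub V k) S.
Proof.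
move=> opt k1 hS hS' hH U0 ab small; have [sF _] := opt.
have [|/subsetPn[B]] := boolP (meet (ksub V k) S \subset F); first by left.
rewrite inE => /andP[BV BS] BF; right.
have k0 : 0 < k%:R :> R by rewrite ltr0n; apply: ltn_trans k1.
have cardA A : A \in F -> #|A| = k.
  by move=> /(subsetP sF); rewrite inE => /andP[_ /eqP].
(* The absent set [B] passes through a point of [S], so it already weighs at least a U, and every
   member weighs more. *)
have big A : A \in F -> a * U < (wt F A)%:R.
  move=> AF; case/set0Pn: BS => x; rewrite inE => /andP[xB xS].
  apply: le_lt_trans (hS x xS) _; rewrite ltr_nat.
  by apply: leq_ltn_trans (swap_lt opt AF BV BF); rewrite /wt (bigD1 x xB) leq_addr.
(* If [A] misses [S] and meets [H] at most in [x], its weight is at most b U + k (U / (4 k)), that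
   is (b + 1/4) U <= a U. *)
have two A x : A \in F -> A :&: S = set0 -> x \in A -> exists2 y, y \in H :\ x & y \in A.
  move=> AF AS xA; have [/exists_inP //|/exists_inPn none] := boolP [exists y in H :\ x, y \in A].
  exfalso.
  have := big A AF; rewrite ltNge => /negP[]; rewrite /wt (bigD1 x xA) /= natrD natr_sum.
  have h1 : (deg F x)%:R <= b * U.
    by apply: hS'; apply/negP => xS; have := in_set0 x; rewrite -AS inE xA xS.
  have h2 : \sum_(i in A | i != x) ((deg F i)%:R : R) <= k%:R * (U / (4 * k%:R)).
    apply: (@le_trans _ _ (\sum_(i in A) U / (4 * k%:R))); last first.
      by rewrite sumr_const; move: (cardA A AF) => ->; rewrite -[X in X <= _]mulr_natl.
    rewrite [X in _ <= X](bigD1 x xA) /= -[X in X <= _]add0r lerD ?divr_ge0 ?mulr_ge0 ?ler0n //.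
    apply: ler_sum => y /andP[yA yx]; apply: hH; apply: contraL yA => yH.
    by apply: none; rewrite !inE yx.
  have h3 : k%:R * (U / (4 * k%:R)) = U / 4 by field; rewrite gt_eqF.
  rewrite h3 in h2; apply: le_trans (lerD h1 h2) _.
  by have := ler_wpM2r U0 ab; lra.
apply/subsetP => A AF; rewrite inE (subsetP sF _ AF) /=; apply/negP => /eqP AS.
(* Every member through a point of [A] meets [S :|: H] in another point, so each of the k degrees in
   [A] is at most (|S| + |H|) p. *)
have := big A AF; rewrite ltNge => /negP[]; apply: le_trans small.
rewrite -!natrM ler_nat -[X in (_ <= X * _)%N](cardA A AF) -sum_nat_const.
apply: leq_sum => x xA.
have xS : x \notin S by apply/negP => xS; have := in_set0 x; rewrite -AS inE xA xS.
apply: (@leq_trans (#|S :|: H| * 'C(#|V| - 2, k - 2))%N); last first.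
  by rewrite leq_mul2r leq_card_setU orbT.
apply: (deg_le_cover sF k1) => A' A'F xA'.
have [A'S|/set0Pn[y]] := eqVneq (A' :&: S) set0.
  have [y] := two A' x A'F A'S xA'; rewrite !inE => /andP[yx yH] yA.
  by exists y => //; rewrite !inE yx yH orbT.
rewrite inE => /andP[yA yS]; exists y => //; rewrite !inE yS andbT.
by apply: contraNneq xS => <-.
Qed.

(** Here e is the largest degree, g the second largest and z the sum of the other large degrees, all
    divided by |F|. First 3/4 <= e (e + z) forces e > 6/10. On [6/10, 8/10] the convex quadratic e^2
    + (1 + 1/600 - e)(1227/1000 - e) stays below 3/4, as it does at both ends, so e >= 8/10. *)
Lemma star_aux (e g z : R) : g <= e -> 0 <= g -> 0 <= z -> 3 / 4 <= e ^+ 2 + g * z ->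
  e + g <= 1 + 1 / 600 -> e + z <= 1227 / 1000 -> e <= 1 ->
  g + 1 / 4 <= e /\ 1 / 2 <= e.
Proof.
move=> ge g0 z0 h eg ez e1.
have e6 : 6 / 10 < e.
  have : 3 / 4 <= e * (1227 / 1000).
    
    have := ler_wpM2r z0 ge; have e0 : 0 <= e by apply: le_trans ge.
    by have := ler_wpM2l e0 ez; move: h; rewrite expr2; lra.
  by lra.
split; last by lra.
suff : 8 / 10 <= e by lra.
rewrite leNgt; apply/negP => e8.
have h1 : g * z <= g * (1227 / 1000 - e) by apply: ler_wpM2l; lra.
have h2 : g * (1227 / 1000 - e) <= (1 + 1 / 600 - e) * (1227 / 1000 - e) by apply: ler_wpM2r; lra.
have h3 : 0 <= (e - 6 / 10) * (8 / 10 - e) by apply: mulr_ge0; lra.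
by move: h h1 h2 h3; rewrite expr2; lra.
Qed.

(* [s] is the total defect of the degrees on [S] from [1]. *)
Lemma concentration (d : T -> R) S X v (r : nat) (delta eps : R) :
  #|S| = r -> v \notin S -> v \in X -> S \subset X ->
  (forall x, 0 <= d x) -> (forall x, x \in S -> d v <= d x <= 1) -> d v <= 1 ->
  (forall x, x \notin S -> d x <= d v) ->
  r%:R + delta ^+ 2 - eps <= \sum_(x in X) d x ^+ 2 ->
  \sum_(x in X) d x <= r%:R + delta + eps -> 0 <= delta <= 1 -> 0 <= eps ->
  (delta <= 1 / 2 -> d v <= delta + 6 * eps /\ forall x, x \in S -> 1 - 5 * eps <= d x) /\
  (1 / 2 <= delta -> delta - 4 * eps <= d v /\
     forall x, x \in X -> x \notin v |: S -> d x <= 5 * eps).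
Proof.
move=> cS vS vX sSX d0 dS dv1 dS' sq lin /andP[de0 de1] eps0.
pose s := \sum_(x in S) (1 - d x); pose z := \sum_(x in X :\: S :\ v) d x.
have vXS : v \in X :\: S by rewrite inE vS.
have split (f : T -> R) : \sum_(x in X) f x =
    \sum_(x in S) f x + (f v + \sum_(x in X :\: S :\ v) f x).
  by rewrite (big_setID S) /= (setIidPr sSX) (big_setD1 v vXS).
rewrite !split in sq lin.
have sumS : \sum_(x in S) d x = r%:R - s.
  by rewrite /s sumrB sumr_const cS opprB addrC subrK.
(* Termwise this is (d x - d v)(1 - d x) >= 0. *)
have sqS : \sum_(x in S) d x ^+ 2 <= r%:R - s - d v * s.
  rewrite -sumS /s mulr_sumr -sumrB; apply: ler_sum => x /dS/andP[h1 h2].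
  have : 0 <= (d x - d v) * (1 - d x) by apply: mulr_ge0; lra.
  by rewrite expr2; lra.
have sqz : \sum_(x in X :\: S :\ v) d x ^+ 2 <= d v * z.
  rewrite mulr_sumr; apply: ler_sum => x; rewrite !inE => /and3P[_ xS _].
  by rewrite expr2 ler_wpM2r // dS'.
have s0 : 0 <= s by apply: sumr_ge0 => x /dS/andP[]; lra.
have z0 : 0 <= z by apply: sumr_ge0.
have sx x : x \in S -> 1 - d x <= s.
  move=> xS; rewrite /s (bigD1 x xS) /= lerDl; apply: sumr_ge0 => y /andP[/dS/andP[]]; lra.
have zx x : x \in X -> x \notin v |: S -> d x <= z.
  rewrite !inE negb_or => xX /andP[xv xS]; rewrite /z (bigD1 x) /= ?lerDl ?sumr_ge0 //.
  by rewrite !inE xv xS xX.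
rewrite sumS -/z in lin.
have dv0 := d0 v; move: (d v) dv0 dv1 sq lin sqS sqz => e e0 e1 sq lin sqS sqz.
have h1 : e + z <= delta + eps + s by lra.
(* The square bound reads delta^2 + s <= eps + e (e + z - s), and the linear bound controls the
   bracket. *)
have h2 : delta ^+ 2 + s <= e * (delta + eps) + eps.
  have := ler_wpM2l e0 h1; move: sq sqS sqz; rewrite !expr2; lra.
have h3 : e * eps <= eps by rewrite -[X in _ <= X]mul1r ler_wpM2r.
have h4 : delta ^+ 2 + s <= e * delta + 2 * eps by rewrite mulrDr in h2; lra.
rewrite expr2 in h4.
split=> de.
  (* Eliminating s between [h1] and [h4] gives (e - delta)(1 - delta) <= 3 eps; the factor 1 - delta
     is at least 1/2. *)
  have h5 : e <= delta + 6 * eps.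
    rewrite leNgt; apply/negP => bad.
    have : 0 <= (e - delta) * (1 / 2 - delta) by apply: mulr_ge0; lra.
    by lra.
  split=> // x /sx.
  have : 0 <= (delta + 6 * eps - e) * delta by apply: mulr_ge0; lra.
  have : 0 <= eps * (1 / 2 - delta) by apply: mulr_ge0; lra.
  by lra.
(* As s >= 0, [h4] gives delta (delta - e) <= 2 eps. Eliminating s then yields z <= (delta - e)(1 -
   delta) + 3 eps <= 5 eps. *)
have h5 : delta - 4 * eps <= e.
  rewrite leNgt; apply/negP => bad.
  have : 0 < (delta - e - 4 * eps) * delta by apply: mulr_gt0; lra.
  have : 0 <= eps * (delta - 1 / 2) by apply: mulr_ge0; lra.
  by lra.
split=> // x xX xS; apply: le_trans (zx x xX xS) _.
have : 0 <= (e - delta + 4 * eps) * (1 - delta) by apply: mulr_ge0; lra.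
have : 0 <= eps * (delta - 1 / 2) by apply: mulr_ge0; lra.
by lra.
Qed.

(* Tail estimate with two cutoffs: the middle range is small since its linear
   sum is already at most [2 m], the low range since all degrees are. *)
Lemma few_carry_squares V k F (D rho : R) (p := ('C(#|V| - 2, k - 2))%:R : R) :
  F \subset ksub V k -> (1 < k)%N -> 0 < D -> 1 <= rho -> #|F|%:R <= rho * D ->
  (180 * 1000) * rho ^+ 3 * k%:R ^+ 2 * p <= D ->
  exists X, [/\ #|X|%:R <= 400 * rho ^+ 2,
    forall x, x \notin X -> (deg F x)%:R <= D / 200 &
    \sum_(x | x \notin X) (deg F x)%:R ^+ 2 <= D ^+ 2 / 50].
Proof.
move=> sF k1 D0 rho1 mD small.
have k0 : 0 < k%:R :> R by rewrite ltr0n; apply: ltn_trans k1.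
have k1' : 1 <= k%:R :> R by rewrite ler1n; apply: ltnW.
have rho0 : 0 < rho by apply: lt_le_trans rho1.
have p0 : 0 <= p by [].
have q1 : 0 < 200 * rho by rewrite mulr_gt0 // ltr0n.
have q2 : 0 < 200 * (rho * k%:R) by rewrite mulr_gt0 ?mulr_gt0 // ltr0n.
have P1 : 0 < D / (200 * rho) by rewrite divr_gt0.
have P2 : 0 < D / (200 * (rho * k%:R)) by rewrite divr_gt0.
pose X1 := [set x | D / (200 * rho) <= (deg F x)%:R].
pose X2 := [set x | D / (200 * (rho * k%:R)) <= (deg F x)%:R].
(* The constant 180 * 1000 is exactly what [few_large] requires at the lower cutoff, that of
   [X2]. *)
have small' : 9 * (rho * D) * p <= 2 * (D / (200 * (rho * k%:R))) ^+ 2.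
  have -> : 2 * (D / (200 * (rho * k%:R))) ^+ 2 = D ^+ 2 / (200 * 100 * (rho ^+ 2 * k%:R ^+ 2)).
    by field; rewrite !gt_eqF.
  have q3 : 0 < 200 * 100 * (rho ^+ 2 * k%:R ^+ 2) by rewrite !mulr_gt0 // ?exprn_gt0 // ltr0n.
  rewrite ler_pdivlMr //.
  have := ler_wpM2r (ltW D0) small; rewrite expr2; lra.
have mp : 9 * #|F|%:R * p <= 9 * (rho * D) * p.
  by rewrite ler_wpM2r // ler_wpM2l // ler0n.
have c2 : #|X2|%:R * (D / (200 * (rho * k%:R))) <= 2 * #|F|%:R.
  apply: (few_large sF k1); first by [].
    by move=> x; rewrite inE.
  exact: (le_trans mp small').
have le12 : D / (200 * (rho * k%:R)) <= D / (200 * rho).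
  rewrite ler_pM2l // lef_pV2 ?posrE // ler_pM2l ?ltr0n //.
  by rewrite ler_peMr // ltW.
have c1 : #|X1|%:R * (D / (200 * rho)) <= 2 * #|F|%:R.
  apply: (few_large sF k1); first by [].
    by move=> x; rewrite inE.
  apply: le_trans mp _; apply: le_trans small' _; rewrite ler_pM2l ?ltr0n //.
  by rewrite lerXn2r ?nnegrE // ltW.
have cX1 : #|X1|%:R <= 400 * rho ^+ 2.
  have := le_trans c1 (ler_wpM2l (ler0n R 2) mD).
  rewrite mulrA ler_pdivrMr // => h.
  by rewrite -(ler_pM2r D0); apply: le_trans h _; rewrite expr2; lra.
have cX2 : #|X2|%:R <= 400 * (rho ^+ 2 * k%:R).
  have := le_trans c2 (ler_wpM2l (ler0n R 2) mD).
  rewrite mulrA ler_pdivrMr // => h.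
  by rewrite -(ler_pM2r D0); apply: le_trans h _; rewrite expr2; lra.
exists X1; split=> //.
  move=> x; rewrite inE -ltNge => /ltW h; apply: le_trans h _.
  rewrite ler_pM2l // lef_pV2 ?posrE //.
  by rewrite ler_peMr // ler0n.
have sX2 : \sum_(x in X2) (deg F x)%:R <= 2 * (rho * D).
  have := bonferroni X2 sF k1; rewrite -(ler_nat R) natrD natrM natr_sum -/p => h.
  apply: le_trans h _; have b2 := ler_wpM2r p0 (bin2_le #|X2|).
  have h2 : #|X2|%:R ^+ 2 <= (400 * (rho ^+ 2 * k%:R)) ^+ 2.
    by rewrite lerXn2r ?nnegrE ?mulr_ge0 ?exprn_ge0 // ltW.
  have h3 := ler_wpM2r p0 h2; rewrite !exprMn in h3.
  have := ler_wpM2l (ltW rho0) small; move: b2 h3 mD.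
  have := mulr_gt0 rho0 D0; lra.
rewrite (bigID (mem X2)) /=.
(* Each square is at most cutoff times degree. The middle range gives D^2 / 100 and the low range,
   with total degree k |F|, gives D^2 / 200. *)
have t1 : \sum_(i | (i \notin X1) && (i \in X2)) (deg F i)%:R ^+ 2 <= D / (200 * rho) * (2 * (rho * D)).
  apply: (@le_trans _ _ (D / (200 * rho) * \sum_(x in X2) (deg F x)%:R)); last first.
    by rewrite ler_wpM2l // ltW.
  rewrite mulr_sumr big_mkcond [X in _ <= X]big_mkcond; apply: ler_sum => x _.
  case: (x \in X2); rewrite ?andbF // andbT inE -ltNge.
  case: ltP => [h|_]; last by rewrite mulr_ge0 // ltW.
  by rewrite expr2 ler_wpM2r // ltW.
have t2 : \sum_(i | (i \notin X1) && (i \notin X2)) (deg F i)%:R ^+ 2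
    <= D / (200 * (rho * k%:R)) * (k%:R * (rho * D)).
  apply: (@le_trans _ _ (D / (200 * (rho * k%:R)) * \sum_x (deg F x)%:R)); last first.
    rewrite ler_wpM2l //; first exact: ltW.
    by rewrite -natr_sum (sum_deg sF) natrM ler_wpM2l // ltW.
  rewrite mulr_sumr big_mkcond; apply: ler_sum => x _.
  rewrite !inE -!ltNge.
  case: ifP => [/andP[_ h]|_]; last by rewrite mulr_ge0 // ltW.
  by rewrite expr2 ler_wpM2r // ltW.
apply: le_trans (lerD t1 t2) _.
have -> : D / (200 * rho) * (2 * (rho * D)) + D / (200 * (rho * k%:R)) * (k%:R * (rho * D)) =
   D ^+ 2 * (3 / 200) by field; rewrite !gt_eqF.
by rewrite ler_wpM2l ?exprn_ge0 ?ltW //; lra.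
Qed.

End Estimates.

(** * Families of sets hitting a given set *)

Section Surgery.
Local Open Scope nat_scope.
Variable T : finType.
Implicit Types (F G P Q : {set {set T}}) (A B S V X Y : {set T}) (x y v : T).

Lemma deg_all F x : (forall A, A \in F -> x \in A) -> deg F x = #|F|.
Proof. by move=> h; apply: eq_card => A; rewrite inE; case: (boolP (A \in F)) => // /h ->. Qed.

Lemma deg_none F x : (forall A, A \in F -> x \notin A) -> deg F x = 0.
Proof. by move=> h; rewrite degE big1 // => A /h /negbTE ->. Qed.

Lemma meet1 F v A : (A \in meet F [set v]) = (A \in F) && (v \in A).
Proof. by rewrite meetE setI_eq0 disjoint_sym disjoints1 negbK. Qed.

Lemma mem_ksubD V k S A :
  (A \in ksub (V :\: S) k) = (A \in ksub V k) && (A :&: S == set0).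
Proof. by rewrite !inE subsetD -setI_eq0 andbAC. Qed.

Lemma ksubS V V' k : V' \subset V -> ksub V' k \subset ksub V k.
Proof.
move=> sV; apply/subsetP => A; rewrite !inE => /andP[sA ->].
by rewrite (subset_trans sA sV).
Qed.

Lemma card_star V k v : v \in V -> 0 < k ->
  #|meet (ksub V k) [set v]| = 'C(#|V| - 1, k - 1).
Proof.
move=> vV k0; rewrite -(deg_ksub vV k0) /deg; apply: eq_card => A.
by rewrite meet1 [in RHS]inE.
Qed.

Lemma deg_meet_in V k S x : S \subset V -> x \in S -> 0 < k ->
  deg (meet (ksub V k) S) x = 'C(#|V| - 1, k - 1).
Proof.
move=> sSV xS k0; have := deg_meet sSV (subsetP sSV _ xS) k0.
by rewrite xS mul0n addn0.
Qed.

Lemma deg_meet_out V k S x : S \subset V -> x \in V -> x \notin S -> 0 < k ->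
  deg (meet (ksub V k) S) x + 'C(#|V| - #|S| - 1, k - 1) = 'C(#|V| - 1, k - 1).
Proof. by move=> sSV xV xS k0; have := deg_meet sSV xV k0; rewrite xS mul1n. Qed.

Lemma meetU_disjoint V k S G : G \subset ksub (V :\: S) k ->
  [disjoint meet (ksub V k) S & G].
Proof.
move=> /subsetP sG; rewrite -setI_eq0; apply/eqP/setP => A; rewrite !inE.
apply/negP => /andP[/andP[_ AS] /sG]; rewrite mem_ksubD => /andP[_].
by rewrite (negbTE AS).
Qed.

(** All points of [V :\: S] have the same degree in [meet (ksub V k) S], so the cross term of the
    squares depends on [#|G|] only. *)
Lemma inter_meetU V k S G : S \subset V -> 0 < k -> G \subset ksub (V :\: S) k ->
  inter (meet (ksub V k) S :|: G) = inter (meet (ksub V k) S) + inter G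
    + 2 * (('C(#|V| - 1, k - 1) - 'C(#|V| - #|S| - 1, k - 1)) * (k * #|G|)).
Proof.
move=> sSV k0 sG; rewrite /inter -(sum_deg sG) !big_distrr -!big_split /=.
apply: eq_bigr => x _; rewrite degU ?meetU_disjoint //.
have [xVS|xVS] := boolP (x \in V :\: S); last by rewrite (deg_notin sG xVS); lia.
move: xVS; rewrite inE => /andP[xS xV]; have := deg_meet_out sSV xV xS k0.
by move=> h; rewrite -[in X in X - _]h addnK; lia.
Qed.

(** By [inter_meetU], once the sets hitting [S] are fixed, maximising over the whole family amounts
    to maximising over the part that avoids [S]. *)
Lemma optimal_remove V k S F : S \subset V -> 0 < k -> optimal V k F ->
  meet (ksub V k) S \subset F ->
  optimal (V :\: S) k (F :\: meet (ksub V k) S).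
Proof.
move=> sSV k0 [sF opt] sLF; have sF' : F :\: meet (ksub V k) S \subset ksub (V :\: S) k.
  apply/subsetP => A; rewrite mem_ksubD inE meetE negb_and negbK.
  by case/andP=> + AF; rewrite (subsetP sF _ AF).
split=> // G sG cG.
have eF : meet (ksub V k) S :|: (F :\: meet (ksub V k) S) = F.
  by rewrite -{1}(setIidPr sLF) setID.
have cU P : P \subset ksub (V :\: S) k ->
    #|meet (ksub V k) S :|: P| = #|meet (ksub V k) S| + #|P|.
  by move=> sP; rewrite cardsU disjoint_setI0 ?meetU_disjoint // cards0 subn0.
have h : inter (meet (ksub V k) S :|: G) <= inter F.
  apply: opt; last by rewrite cU // cG -cU // eF.
  by rewrite subUset meet_sub (subset_trans sG) // ksubS // subsetDl.
by move: h; rewrite -{1}eF !inter_meetU // cG leq_add2r leq_add2l.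
Qed.

Lemma deg_remove V k S F x : S \subset V -> 0 < k -> meet (ksub V k) S \subset F ->
  x \in V -> x \notin S ->
  deg F x = 'C(#|V| - 1, k - 1) - 'C(#|V| - #|S| - 1, k - 1)
    + deg (F :\: meet (ksub V k) S) x.
Proof.
move=> sSV k0 sLF xV xS.
have {1}-> : F = meet (ksub V k) S :|: (F :\: meet (ksub V k) S).
  by rewrite -{1}(setIidPr sLF) setID.
rewrite degU; last by rewrite -setI_eq0 setIDA setIC setDIl setDv setI0.
by rewrite -(deg_meet_out sSV xV xS k0) addnK.
Qed.

(** The comparison family consists of all sets hitting [S] and M sets through [v] avoiding [S]; only
    the degrees on [S] and at [v] are retained. *)
Lemma inter_ge V k S v F M : S \subset V -> v \in V -> v \notin S -> 0 < k ->
  optimal V k F -> #|F| = #|meet (ksub V k) S| + M ->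
  M <= 'C(#|V| - #|S| - 1, k - 1) ->
  #|S| * 'C(#|V| - 1, k - 1) ^ 2
   + ('C(#|V| - 1, k - 1) - ('C(#|V| - #|S| - 1, k - 1) - M)) ^ 2 <= inter F.
Proof.
move=> sSV vV vS k0 [sF opt] cF MN.
have vVS : v \in V :\: S by rewrite inE vS vV.
have cM : M <= #|meet (ksub (V :\: S) k) [set v]| by rewrite card_star // cardsDS.
have [Q sQ cQ] := subset_of_card cM.
have sQ' : Q \subset ksub (V :\: S) k := subset_trans sQ (meet_sub _ _).
apply: leq_trans (opt (meet (ksub V k) S :|: Q) _ _); last first.
- by rewrite cardsU disjoint_setI0 ?meetU_disjoint // cards0 subn0 cQ cF.
- by rewrite subUset meet_sub (subset_trans sQ') // ksubS // subsetDl.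
rewrite /inter (bigID (mem S)) /= leq_add //.
  rewrite -sum_nat_const; apply: leq_sum => x xS.
  by rewrite leq_exp2r // degU ?meetU_disjoint // (deg_meet_in sSV xS k0) leq_addr.
rewrite (bigD1 v) //=; apply: leq_trans (leq_addr _ _).
rewrite leq_exp2r // degU ?meetU_disjoint //.
rewrite (@deg_all Q v) ?cQ => [|A /(subsetP sQ)]; last by rewrite meet1 => /andP[].
by have := deg_meet_out sSV vV vS k0; lia.
Qed.

(** Expansion of the squares of deg L - deg P, where deg L is D on [S] and D - N on the rest of [V].
    The negative cross term stands on the left to avoid truncated subtraction. *)
Lemma inter_meetD V k S P : S \subset V -> 0 < k -> P \subset meet (ksub V k) S ->
  inter (meet (ksub V k) S :\: P)
   + 2 * ('C(#|V| - #|S| - 1, k - 1) * \sum_(x in S) deg P x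
          + ('C(#|V| - 1, k - 1) - 'C(#|V| - #|S| - 1, k - 1)) * (k * #|P|))
  = inter (meet (ksub V k) S) + inter P.
Proof.
move=> sSV k0 sP; have sP' := subset_trans sP (meet_sub _ _).
rewrite -(sum_deg sP') [\sum_(x in S) _]big_mkcond !big_distrr -big_split /=.
rewrite big_distrr /inter -!big_split /=; apply: eq_bigr => x _.
have eL : meet (ksub V k) S = (meet (ksub V k) S :\: P) :|: P.
  by rewrite setUC -{1}(setIidPr sP) setID.
have := degU x (_ : [disjoint meet (ksub V k) S :\: P & P]); rewrite -eL => -> //; last first.
  by rewrite -setI_eq0 setIDAC -setIDA setDv setI0.
have [xV|xV] := boolP (x \in V); last first.
  rewrite (deg_notin sP' xV) (@deg_notin T V k) //; last first.
    by rewrite (subset_trans (subsetDl _ _)) // meet_sub.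
  by case: ifP; lia.
have := deg_meet sSV xV k0; rewrite {1}eL degU; last first.
  by rewrite -setI_eq0 setIDAC -setIDA setDv setI0.
have := @leq_bin2l (#|V| - #|S| - 1) (#|V| - 1) (k - 1) ltac:(lia).
move: ('C(#|V| - 1, k - 1)) ('C(#|V| - #|S| - 1, k - 1)) => D N /subnKC <-.
rewrite addKn; move: (D - N) => t; case: (x \in S) => /=; nia.
Qed.

Lemma deg_meet_out_le V k S x : 1 < k -> x \notin S ->
  deg (meet (ksub V k) S) x <= #|S| * 'C(#|V| - 2, k - 2).
Proof.
move=> k1 xS; apply: (deg_le_cover (meet_sub _ _) k1) => A; rewrite meetE.
move=> /andP[_ /set0Pn[y]]; rewrite inE => /andP[yA yS] xA; exists y => //.
by rewrite !inE yS andbT; apply: contraNneq xS => <-.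
Qed.

End Surgery.

(** * Structure of optimal families *)

Section Structure.
Variable T : finType.
Implicit Types (F G P Q : {set {set T}}) (A B H S V X Y : {set T}) (x y v : T).

Lemma optimal_le_star V k F v : optimal V k F -> (1 < k)%N -> v \in V ->
  (#|F| <= 'C(#|V| - 1, k - 1))%N -> (#|F| ^ 2 <= inter F)%N.
Proof.
move=> [sF opt] k1 vV cF; have k0 := ltnW k1.
rewrite -(card_star vV k0) in cF; have [Q sQ cQ] := subset_of_card cF.
apply: leq_trans (opt Q _ cQ); last exact: subset_trans sQ (meet_sub _ _).
rewrite -cQ /inter (bigD1 v) //= (@deg_all _ Q v) ?leq_addr // => A /(subsetP sQ).
by rewrite meet1 => /andP[].
Qed.

(** The case r = 0 at scale |F|: comparison with part of a star shows that one degree dominates, and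
    [meet_dichotomy] with [S] the singleton of [v] concludes. *)
Lemma optimal_in_star (R : realFieldType) V k F v : optimal V k F -> (1 < k)%N -> v \in V ->
  (forall x, (deg F x <= deg F v)%N) ->
  (#|F| <= 'C(#|V| - 1, k - 1))%N -> (150 * k ^ 2 * 'C(#|V| - 2, k - 2) <= #|F|)%N ->
  F \subset meet (ksub V k) [set v].
Proof.
move=> opt k1 vV vmax cF small; have k0 := ltnW k1; have [sF _] := opt.
have [F0|F0] := posnP #|F|.
  by move/eqP: F0; rewrite cards_eq0 => /eqP ->; apply: sub0set.
have sq := optimal_le_star opt k1 vV cF.
have m0 : 0 < #|F|%:R :> R by rewrite ltr0n.
have kr0 : 0 < k%:R :> R by rewrite ltr0n.
have kr2 : 2 <= k%:R :> R by rewrite ler_nat.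
pose p : R := ('C(#|V| - 2, k - 2))%:R; have p0 : 0 <= p by rewrite ler0n.
pose m : R := #|F|%:R; rewrite -/m in m0.
have smallr : 150 * k%:R ^+ 2 * p <= m by rewrite -natrX -!natrM ler_nat.
(* With this cutoff the points outside [H] contribute at most (m / (4 k)) (k m) = m^2 / 4 to the sum
   of squares, and k of them weigh at most m / 4. *)
pose H := [set x | m / (4 * k%:R) <= (deg F x)%:R].
have th0 : 0 < m / (4 * k%:R) by rewrite divr_gt0 // mulr_gt0.
have cH : #|H|%:R <= 8 * k%:R :> R.
  have : #|H|%:R * (m / (4 * k%:R)) <= 2 * m.
    apply: (few_large sF k1) => //; first by move=> x; rewrite inE.
    rewrite -/p -/m; have -> : 2 * (m / (4 * k%:R)) ^+ 2 = m ^+ 2 / (8 * k%:R ^+ 2).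
      by field; rewrite gt_eqF.
    rewrite ler_pdivlMr ?mulr_gt0 ?exprn_gt0 //.
    have := ler_wpM2l (ltW m0) smallr.
    have : 0 <= m * (k%:R ^+ 2 * p) by rewrite !mulr_ge0 ?exprn_ge0 // ltW.
    by rewrite expr2; lra.
  have -> : 2 * m = 8 * k%:R * (m / (4 * k%:R)) by field; rewrite gt_eqF.
  by rewrite ler_pM2r.
have hH x : x \notin H -> (deg F x)%:R <= m / (4 * k%:R).
  by rewrite inE -ltNge => /ltW.
have low : \sum_(x | x \notin H) (deg F x)%:R ^+ 2 <= m ^+ 2 / 4 :> R.
  apply: (@le_trans _ _ (\sum_x (m / (4 * k%:R)) * (deg F x)%:R)).
    rewrite big_mkcond; apply: ler_sum => x _; case: ifP => [/hH h|_].
      by rewrite expr2 ler_wpM2r.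
    by rewrite mulr_ge0 // ltW.
  rewrite -mulr_sumr -natr_sum (sum_deg sF) natrM -/m le_eqVlt; apply/orP; left.
  by apply/eqP; field; rewrite gt_eqF.
have sqr : m ^+ 2 <= \sum_x (deg F x)%:R ^+ 2.
  by move: sq; rewrite -(ler_nat R) natrX natr_sum; under eq_bigr do rewrite natrX.
rewrite (bigID (mem H)) /= in sqr.
have vH : v \in H.
  apply: contraT => vH; have H0 x : x \in H = false.
    apply/negbTE; apply: contra vH; rewrite !inE => h; apply: le_trans h _.
    by rewrite ler_nat.
  move: sqr low; rewrite big_pred0 // add0r.
  have : 0 < m ^+ 2 by rewrite exprn_gt0.
  by lra.
pose g := (\max_(x | x != v) deg F x)%N.
have gx x : x != v -> (deg F x <= g)%N by exact: (@leq_bigmax_cond _ (fun x => x != v) (deg F)).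
have ge : (g <= deg F v)%N by apply/bigmax_leqP => x _.
have gp : (deg F v + g <= #|F| + 'C(#|V| - 2, k - 2))%N.
  have dv := leq_trans (deg_le_card F v) (leq_addr 'C(#|V| - 2, k - 2) #|F|).
  rewrite -leq_subRL //; apply/bigmax_leqP => x xv; rewrite leq_subRL //.
  have := bonferroni [set v; x] sF k1.
  by rewrite cards2 eq_sym xv binn mul1n (big_setU1 v) ?inE 1?eq_sym //= big_set1.
have lin : \sum_(x in H) (deg F x)%:R <= m * (1227 / 1000) :> R.
  have := bonferroni H sF k1; rewrite -(ler_nat R) natrD natrM natr_sum -/p -/m => h.
  apply: le_trans h _; have b2 := ler_wpM2r p0 (bin2_le R #|H|).
  have h2 : #|H|%:R ^+ 2 <= (8 * k%:R) ^+ 2 :> R.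
    by rewrite lerXn2r ?nnegrE // mulr_ge0 // ltW.
  have h3 := ler_wpM2r p0 h2; rewrite exprMn in h3.
  by move: b2 h3; lra.
pose z : R := \sum_(x in H :\ v) (deg F x)%:R.
have z0 : 0 <= z by apply: sumr_ge0.
have [] := @star_aux R ((deg F v)%:R / m) (g%:R / m) (z / m).
- by rewrite ler_pM2r ?invr_gt0 // ler_nat.
- by rewrite divr_ge0 // ltW.
- by rewrite divr_ge0 // ltW.
- have -> : ((deg F v)%:R / m) ^+ 2 + g%:R / m * (z / m) = ((deg F v)%:R ^+ 2 + g%:R * z) / m ^+ 2.
    by field; rewrite gt_eqF.
  rewrite ler_pdivlMr ?exprn_gt0 //.
  have h : \sum_(x in H) (deg F x)%:R ^+ 2 <= (deg F v)%:R ^+ 2 + g%:R * z.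
    rewrite (big_setD1 v vH) /= lerD2l /z mulr_sumr; apply: ler_sum => x.
    by rewrite !inE => /andP[xv _]; rewrite expr2 ler_wpM2r // ler_nat gx.
  by move: sqr low h; lra.
(* The 1/600 comes from 150 k^2 p <= m with k >= 2. *)
- rewrite -mulrDl ler_pdivrMr //.
  have gp' : (deg F v)%:R + g%:R <= m + p by rewrite -!natrD ler_nat.
  have k4 : 4 <= k%:R ^+ 2 :> R by rewrite -natrX ler_nat (@leq_exp2r 2 k 2).
  have := ler_wpM2r p0 k4; lra.
- rewrite -mulrDl ler_pdivrMr //; move: lin; rewrite (big_setD1 v vH) /= -/z.
  by rewrite mulrC.
- by rewrite ler_pdivrMr // mul1r ler_nat deg_le_card.
move=> ab a2.
have [] := @meet_dichotomy R T V k F [set v] H m ((deg F v)%:R / m) (g%:R / m) opt k1 _ _ hH.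
- by move=> x /set1P ->; rewrite divfK // gt_eqF.
- by move=> x; rewrite inE => xv; rewrite divfK ?gt_eqF // ler_nat gx.
- exact: ltW.
- by [].
- rewrite -/p; apply: (@le_trans _ _ (1 / 2 * m)); last by rewrite ler_wpM2r // ltW.
  rewrite cards1 natrD; have h : 1 + #|H|%:R <= 9 * k%:R :> R by move: cH kr2; lra.
  have := ler_wpM2l (ltW kr0) (ler_wpM2r p0 h); move: smallr m0; rewrite expr2; lra.
(* A star contained in [F] equals [F], since |F| is at most the size of the star. *)
- move=> sub; have /eqP -> // : meet (ksub V k) [set v] == F.
  by rewrite eqEcard sub card_star.
- by [].
Qed.

(* Here the family [P] of sets missing from [meet (ksub V k) (v |: S)] plays the role of [F]:
   optimality forces almost all of [P] into the star of [v]. *)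
Lemma optimal_sup_meet V k F S v P :
  P = meet (ksub V k) (v |: S) :\: F -> optimal V k F -> (1 < k)%N -> S \subset V -> v \in V -> v \notin S ->
  F \subset meet (ksub V k) (v |: S) ->
  (forall x, x \in S -> (deg F v <= deg F x)%N) ->
  (#|P| < 'C(#|V| - #|S| - 1, k - 1))%N ->
  (#|P| <= 2 * 'C(#|V| - #|v |: S| - 1, k - 1))%N ->
  (4 * k * (#|v |: S| * 'C(#|V| - 2, k - 2)) <= #|P|)%N ->
  meet (ksub V k) S \subset F.
Proof.
move=> defP opt k1 sSV vV vS sFL vmin PN PN' Psmall; have k0 := ltnW k1; have [sF opt'] := opt.
set S' := v |: S in sFL PN' Psmall defP *.
have sS'V : S' \subset V by rewrite subUset sub1set vV.
have vS' : v \in S' by rewrite !inE eqxx.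
have SS' x : x \in S -> x \in S' by move=> xS; rewrite !inE xS orbT.
set L := meet (ksub V k) S' in sFL defP *.
have sPL : P \subset L by rewrite defP subsetDl.
have sPV : P \subset ksub V k := subset_trans sPL (meet_sub _ _).
have FE : F = L :\: P by rewrite defP setDDr setDv set0U (setIidPr sFL).
have degP x : (deg F x + deg P x = deg L x)%N.
  rewrite {1}FE -degU; last by rewrite -setI_eq0 setIDAC -setIDA setDv setI0.
  by rewrite setUC -{1}(setIidPr sPL) setID.
set D := 'C(#|V| - 1, k - 1); set N' := 'C(#|V| - #|S'| - 1, k - 1) in PN' *.
set N := 'C(#|V| - #|S| - 1, k - 1) in PN *.
set p := 'C(#|V| - 2, k - 2) in Psmall *.
have degPv x : x \in S' -> (deg F x + deg P x = D)%N.
  by move=> xS; rewrite degP deg_meet_in.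
set Q1 := meet (ksub (V :\: S) k) [set v].
have cQ1 : #|Q1| = N by rewrite /Q1 card_star ?inE ?vS ?vV // cardsDS.
have sQ1V A : A \in Q1 -> [/\ A \in ksub V k, A :&: S = set0 & v \in A].
  by rewrite meet1 mem_ksubD => /andP[/andP[-> /eqP ->] ->].
have sQ1L : Q1 \subset L.
  apply/subsetP => A /sQ1V[AV _ vA]; rewrite meetE AV; apply/set0Pn; exists v.
  by rewrite inE vA.
have PQ : (#|P| <= #|Q1|)%N by rewrite cQ1 ltnW.
(* The competitor omits [Q] in place of [P]: equally many sets, all through [v] and avoiding [S]. *)
have [Q sQ cQ] := subset_of_card PQ.
have degQ : (\sum_(x in S') deg Q x = #|P|)%N.
  rewrite (big_setU1 v vS) /= big1 => [|x xS].
    by rewrite addn0 -cQ deg_all // => A /(subsetP sQ)/sQ1V[].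
  apply: deg_none => A /(subsetP sQ)/sQ1V[_ AS _]; apply/negP => xA.
  by have := in_set0 x; rewrite -AS inE xA xS.
have sQL := subset_trans sQ sQ1L.
have cmp : (inter (L :\: Q) <= inter F)%N.
  apply: opt'; first by apply: subset_trans (subsetDl _ _) (meet_sub _ _).
  by rewrite FE !cardsDS // cQ.
have eQ := inter_meetD sS'V k0 sQL; have eP := inter_meetD sS'V k0 sPL.
rewrite -/L -/D -/N' -FE in eP; rewrite -/L -/D -/N' degQ cQ in eQ.
have QQ : (#|P| ^ 2 <= inter Q)%N.
  rewrite -cQ /inter (bigD1 v) //= (@deg_all _ Q v) ?leq_addr // => A /(subsetP sQ).
  by case/sQ1V.
set E := (\sum_(x in S') deg P x)%N in eP.
have PE : (#|P| <= E)%N.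
  rewrite /E sum_deg_on -sum1_card; apply: leq_sum => A /(subsetP sPL).
  by rewrite meetE card_gt0 => /andP[].
set q := (#|S'| * p)%N in Psmall *.
have out x : x \notin S' -> (deg L x <= q)%N by apply: deg_meet_out_le.
(* On [v |: S] the degree of [F] is least at [v], so that of [P] is largest there; elsewhere the
   degree in [P] is at most q. *)
have PP : (inter P <= deg P v * E + q * (k * #|P|))%N.
  rewrite -(sum_deg sPV) /inter (bigID (mem S')) /= leq_add //.
    rewrite big_distrr /=; apply: leq_sum => x xS; rewrite -mulnn leq_mul2r.
    apply/orP; right.
    have aux (a b c d : nat) : (a <= b -> b + c = D -> a + d = D -> c <= d)%N by clear; lia.
    by apply: aux (degPv x xS) (degPv v vS'); case/setU1P: xS => [->|/vmin].
  rewrite [X in (_ <= _ * X)%N](bigID (mem S')) /= mulnDr.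
  apply: leq_trans (leq_addl _ _); rewrite big_distrr /=.
  apply: leq_sum => x xS; rewrite -mulnn leq_mul2r; apply/orP; right.
  by apply: leq_trans (out x xS); rewrite -degP leq_addl.
have evP : (deg P v <= #|P|)%N := deg_le_card P v.
(* With m = |P| and e = deg P v, comparing [eP] and [eQ] gives m^2 + 2 N' (E - m) <= e E + q k m.
   Since e <= m <= 2 N' and m <= E, this yields m (m - e) <= q k m. *)
have ev : (#|P| <= deg P v + q * k)%N.
  have [->//|P0] := posnP #|P|.
  move: cmp eQ eP QQ PE PP evP PN' P0; rewrite -mulnn.
  move: (inter F) (inter L) (inter P) (inter Q) (inter _) (deg P v) #|P| => f l p' q' g e m.
  by move: (D - N')%N; clear; nia.
apply/subsetP => A; rewrite meetE => /andP[AV /set0Pn[i]]; rewrite inE => /andP[iA iS].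
apply: contraT => AF.
have ei : (deg P v + deg P i <= #|P| + p)%N.
  have iv : v != i by apply: contraNneq vS => ->.
  have := bonferroni [set v; i] sPV k1.
  by rewrite cards2 iv binn mul1n (big_setU1 v) ?inE //= big_set1.
(* [P] is too small to contain every set through [v] avoiding [S], so some such [B] lies in [F].
   Exchanging it for [A] gives deg P v < deg P i + (k - 1) q, whereas [ev] and [ei] make deg P i
   small and deg P v close to |P| >= 4 k q. *)
have [B BQ BF] : exists2 B, B \in Q1 & B \in F.
  have : ~~ (Q1 \subset P) by apply: contraL PN => /subset_leq_card; rewrite cQ1 -leqNgt.
  case/subsetPn => B BQ BP; exists B => //.
  by rewrite FE inE BP (subsetP sQ1L).
have [BV BS vB] := sQ1V B BQ.
have := swap_lt opt BF AV AF.
have wA : (deg F i <= wt F A)%N by rewrite /wt (bigD1 i iA) leq_addr.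
have wB : (wt F B <= deg F v + (k - 1) * q)%N.
  rewrite /wt (big_setD1 v vB) /= leq_add2l.
  have cB : #|B :\ v| = (k - 1)%N.
    by move: BV; rewrite inE (cardsD1 v B) vB => /andP[_ /eqP <-]; rewrite addKn.
  rewrite -cB -sum_nat_const; apply: leq_sum => x; rewrite !inE => /andP[xv xB].
  apply: (@leq_trans (deg L x)); first by rewrite -degP leq_addr.
  apply: out; rewrite !inE negb_or xv; apply/negP => xS.
  by have := in_set0 x; rewrite -BS inE xB xS.
have := degPv v vS'; have := degPv i (SS' i iS).
have p_q : (p <= q)%N by rewrite /q leq_pmull // card_gt0; apply/set0Pn; exists v.
move: wA wB p_q ei ev Psmall.
move: (wt F A) (wt F B) (deg F v) (deg F i) (deg P v) (deg P i) #|P| => wa wb a b c d m.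
by move: k1; clear; nia.
Qed.

End Structure.

(** * Binomial estimates *)

Lemma bin_codeg_le (n k : nat) : (1 < k)%N -> (1 < n)%N ->
  ('C(n - 2, k - 2) * n <= k * 'C(n - 1, k - 1))%N.
Proof.
case: k => [//|[//|k]] _; case: n => [//|[//|n]] _; rewrite !subSS !subn0.
(* In the original variables the exact identity has factors n - 1 and k - 1; Pascal's rule supplies
   the missing term on each side. *)
have := mul_bin_diag n.+1 k; rewrite binS /=; nia.
Qed.

(** Apply Pascal's rule s times; each step loses at most C(n - 2, k - 2). *)
Lemma bin_drop_le (n k s : nat) : (1 < k)%N ->
  ('C(n - 1, k - 1) <= 'C(n - s - 1, k - 1) + s * 'C(n - 2, k - 2))%N.
Proof.
case: k => [//|[//|k]] _; rewrite !subSS !subn0.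
elim: s => [|s IH]; first by rewrite subn0 addn0.
apply: leq_trans IH _; rewrite mulSn addnA leq_add2r.
have [ns|ns] := leqP (n - s - 1) 0.
  by move: ns; rewrite leqn0 => /eqP ->; rewrite bin0n.
have -> : (n - s - 1 = (n - s.+1 - 1).+1)%N by lia.
by rewrite binS leq_add2l leq_bin2l //; lia.
Qed.

(** * Degree profile and structure theorem *)

Section Profile.
Variables (R : realFieldType) (T : finType).
Implicit Types (F G P Q : {set {set T}}) (A B H S V X Y : {set T}) (x y v : T).

Lemma card_meet_le V k S : S \subset V -> (0 < k)%N ->
  (#|meet (ksub V k) S| <= #|S| * 'C(#|V| - 1, k - 1))%N.
Proof.
move=> sSV k0; rewrite -sum1_card -sum_nat_const.
under [X in (_ <= X)%N]eq_bigr => x xS do rewrite -(deg_meet_in sSV xS k0).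
rewrite sum_deg_on; apply: leq_sum => A.
by rewrite meetE card_gt0 => /andP[].
Qed.

(** The sets gained are those through [v] avoiding [S]; Pascal's rule performs the count. *)
Lemma card_meetU1 V k S v : S \subset V -> v \in V -> v \notin S -> (0 < k)%N ->
  #|meet (ksub V k) (v |: S)| = (#|meet (ksub V k) S| + 'C(#|V| - #|S| - 1, k - 1))%N.
Proof.
move=> sSV vV vS k0; have sS'V : v |: S \subset V by rewrite subUset sub1set vV.
have := card_meet k sSV; have := card_meet k sS'V.
have := subset_leq_card sS'V; rewrite cardsU1 vS add1n => lt h1 h2.
have e1 : (#|V| - #|S| = (#|V| - #|S|.+1).+1)%N by lia.
have e2 : (k = (k - 1).+1)%N by lia.
have : ('C(#|V| - #|S|, k) = 'C(#|V| - #|S|.+1, k) + 'C(#|V| - #|S|.+1, k - 1))%N.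
  by rewrite e1 {1 2}e2 binS.
have -> : (#|V| - #|S| - 1 = #|V| - #|S|.+1)%N by lia.
by move: h1 h2; clear; lia.
Qed.

(** This is [concentration] for the degrees divided by D, with eps = 1/50. The factor rho bounds |F|
    / D. *)
Lemma degree_profile V k F S v (delta : R) (rho := (#|S| + 1)%N%:R : R)
    (D := ('C(#|V| - 1, k - 1))%:R : R) :
  optimal V k F -> (1 < k)%N -> S \subset V -> v \in V -> v \notin S ->
  (forall x, x \in S -> (deg F v <= deg F x)%N) ->
  (forall x, x \notin S -> (deg F x <= deg F v)%N) ->
  (3000 * 3000) * (rho ^+ 3 * (k + #|S|)%N%:R * k%:R * ('C(#|V| - 2, k - 2))%:R) <= D ->
  0 < D -> #|F|%:R = #|meet (ksub V k) S|%:R + delta * ('C(#|V| - #|S| - 1, k - 1))%:R ->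
  0 <= delta <= 1 ->
  (delta <= 1 / 2 -> (deg F v)%:R <= (delta + 6 / 50) * D /\
     forall x, x \in S -> 9 / 10 * D <= (deg F x)%:R) /\
  (1 / 2 <= delta -> (delta - 4 / 50) * D <= (deg F v)%:R /\
     forall x, x \notin v |: S -> (deg F x)%:R <= 1 / 10 * D).
Proof.
move=> opt k1 sSV vV vS vmin vmax small D0 cF /andP[de0 de1].
have k0 := ltnW k1; have [sF _] := opt.
set p : R := ('C(#|V| - 2, k - 2))%:R in small *.
set N : R := ('C(#|V| - #|S| - 1, k - 1))%:R in cF *.
have p0 : 0 <= p by rewrite ler0n.
have N0 : 0 <= N by rewrite ler0n.
have ND : N <= D by rewrite ler_nat leq_bin2l // leq_sub2r // leq_subr.
have k2 : 2 <= k%:R :> R by rewrite ler_nat.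
have rhoE : rho = #|S|%:R + 1 by rewrite /rho natrD.
have rho1 : 1 <= rho by rewrite rhoE lerDr.
have rho0 : 0 < rho by apply: lt_le_trans rho1.
have cL : #|meet (ksub V k) S|%:R <= #|S|%:R * D :> R.
  by rewrite -natrM ler_nat card_meet_le.
have mD : #|F|%:R <= (#|S|%:R + delta) * D.
  by rewrite cF mulrDl lerD // ler_wpM2l.
have mrho : #|F|%:R <= rho * D.
  by apply: le_trans mD _; rewrite rhoE ler_wpM2r ?lerD2l // ltW.
have rhop0 : 0 <= rho ^+ 3 * p by rewrite mulr_ge0 ?exprn_ge0 // ltW.
have kS : k%:R <= (k + #|S|)%N%:R :> R by rewrite ler_nat leq_addr.
have rS : rho <= (k + #|S|)%N%:R by rewrite ler_nat addnC leq_add2r.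
have kr0 : 0 <= k%:R :> R by rewrite ler0n.
(* The factor k + |S| is at least k and at least rho; the two readings serve the tail estimate and
   the Bonferroni error respectively. *)
have small1 : 3000 * 3000 * (rho ^+ 3 * k%:R ^+ 2 * p) <= D.
  have : 0 <= rho ^+ 3 * p * k%:R * ((k + #|S|)%N%:R - k%:R).
    by rewrite !mulr_ge0 ?exprn_ge0 ?(ltW rho0) // subr_ge0.
  by move: small; clear; lra.
have small2 : 3000 * 3000 * (rho ^+ 4 * 2 * p) <= D.
  have : 0 <= rho ^+ 3 * p * k%:R * ((k + #|S|)%N%:R - rho).
    by rewrite !mulr_ge0 ?exprn_ge0 ?(ltW rho0) // subr_ge0.
  have : 0 <= rho ^+ 4 * p * (k%:R - 2).
    by rewrite !mulr_ge0 ?exprn_ge0 ?(ltW rho0) // subr_ge0.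
  by move: small; clear; lra.
have [X [cX outX tail]] : exists X, [/\ #|X|%:R <= 400 * rho ^+ 2,
    forall x, x \notin X -> (deg F x)%:R <= D / 200 &
    \sum_(x | x \notin X) (deg F x)%:R ^+ 2 <= D ^+ 2 / 50].
  apply: few_carry_squares sF k1 D0 rho1 mrho _; rewrite -/p.
  have : 0 <= rho ^+ 3 * k%:R ^+ 2 * p by rewrite !mulr_ge0 ?exprn_ge0 // ltW.
  by move: small1; clear; lra.
(* [X'] holds [S], [v] and every point of large degree, yet only O(rho^2) points, so the Bonferroni
   error O(rho^4 p) is below D / 50. *)
pose X' := v |: (S :|: X).
have cX' : #|X'|%:R <= 401 * rho ^+ 2.
  have : #|X'|%:R <= rho + #|X|%:R.
    rewrite /rho -natrD ler_nat; apply: leq_trans (leq_card_setU _ _) _.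
    by rewrite cards1 [(#|S| + 1)%N]addnC -addnA leq_add2l leq_card_setU.
  have : rho <= rho ^+ 2 by rewrite expr2 ler_pMr.
  by move: cX; clear; lra.
have lin : \sum_(x in X') (deg F x)%:R <= (#|S|%:R + delta + 1 / 50) * D.
  have := bonferroni X' sF k1; rewrite -(ler_nat R) natrD natrM natr_sum -/p => h.
  apply: le_trans h _; have b2 := ler_wpM2r p0 (bin2_le R #|X'|).
  have h2 : #|X'|%:R ^+ 2 <= (401 * rho ^+ 2) ^+ 2.
    by rewrite lerXn2r ?nnegrE // mulr_ge0 ?exprn_ge0 // ltW.
  have h3 := ler_wpM2r p0 h2; rewrite exprMn -exprM in h3.
  have h4 : 0 <= rho ^+ 4 * p by rewrite mulr_ge0 ?exprn_ge0 // ltW.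
  by move: b2 h3 mD small2 h4; clear; lra.
clear small small1 small2.
have sq : (#|S|%:R + delta ^+ 2 - 1 / 50) * D ^+ 2 <= \sum_(x in X') (deg F x)%:R ^+ 2.
  have M0 : (#|meet (ksub V k) S| <= #|F|)%N.
    by rewrite -(ler_nat R) cF lerDl mulr_ge0.
  have eM : (#|F| - #|meet (ksub V k) S|)%N%:R = delta * N :> R.
    by rewrite natrB // cF addrAC subrr add0r.
  have MN : (#|F| - #|meet (ksub V k) S| <= 'C(#|V| - #|S| - 1, k - 1))%N.
    by rewrite -(ler_nat R) eM ler_piMl.
  have := inter_ge sSV vV vS k0 opt (esym (subnKC M0)) MN.
  rewrite -(ler_nat R) natrD natrM !natrX natrB; last first.
    by apply: leq_trans (leq_subr _ _) _; rewrite leq_bin2l // leq_sub2r // leq_subr.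
  rewrite natrB // eM -/N -/D /inter natr_sum.
  under eq_bigr do rewrite natrX.
  rewrite (bigID (mem X')) /=.
  have : \sum_(x | x \notin X') (deg F x)%:R ^+ 2 <= D ^+ 2 / 50 :> R.
    apply: le_trans tail; rewrite [X in X <= _]big_mkcond [X in _ <= X]big_mkcond /=.
    apply: ler_sum => x _; rewrite !inE !negb_or.
    case: (x \notin X); first by rewrite andbT; case: ifP => // _; rewrite sqr_ge0.
    by rewrite !andbF.
  (* In the comparison family of [inter_ge] the degree of [v] is at least delta D, because (1 -
     delta)(D - N) >= 0. *)
  have : (delta * D) ^+ 2 <= (D - (N - delta * N)) ^+ 2.
    have h : 0 <= (1 - delta) * (D - N) by rewrite mulr_ge0 // subr_ge0.
    rewrite lerXn2r ?nnegrE ?mulr_ge0 ?(ltW D0) //; first by have := mulr_ge0 de0 N0; lra.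
    by move: h; lra.
  by rewrite exprMn; lra.
have [] := @concentration R T (fun x => (deg F x)%:R / D) S X' v #|S| delta (1 / 50).
- by [].
- exact: vS.
- by rewrite !inE eqxx.
- by apply/subsetP => x xS; rewrite !inE xS orbT.
- by move=> x; rewrite divr_ge0 // ltW.
- move=> x xS; rewrite ler_pM2r ?invr_gt0 // ler_nat vmin //= ler_pdivrMr // mul1r.
  by rewrite ler_nat (deg_le _ sF).
- by rewrite ler_pdivrMr // mul1r ler_nat (deg_le _ sF).
- by move=> x xS; rewrite ler_pM2r ?invr_gt0 // ler_nat vmax.
- under eq_bigr do rewrite exprMn.
  by rewrite -mulr_suml exprVn ler_pdivlMr ?exprn_gt0.
- by rewrite -mulr_suml ler_pdivrMr.
- by rewrite de0.
- by lra.
move=> lo hi; split=> de.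
  have [h1 h2] := lo de; split; first by move: h1; rewrite ler_pdivrMr //; lra.
  by move=> x /h2; rewrite ler_pdivlMr //; lra.
have [h1 h2] := hi de; split; first by move: h1; rewrite ler_pdivlMr //; lra.
move=> x xS; have [xX|] := boolP (x \in X').
  by have := h2 x xX xS; rewrite ler_pdivrMr //; lra.
rewrite 3!inE 2!negb_or => /and3P[_ _ /outX] h; apply: le_trans h _; lra.
Qed.

(** [meet_dichotomy] at scale D: with cutoff D / (4 k), [few_large] gives |H| <= 8 k rho, and then k
    (|S| + |H|) p <= 9 k^2 rho p <= D / 4. *)
Lemma meet_dichotomy_scaled V k F S (D rho a b : R) (p := ('C(#|V| - 2, k - 2))%:R : R) :
  optimal V k F -> (1 < k)%N -> 0 < D -> 1 <= rho -> #|F|%:R <= rho * D ->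
  #|S|%:R <= rho -> 1000 * (k%:R ^+ 2 * rho * p) <= D -> b + 1 / 4 <= a -> 1 / 4 <= a ->
  (forall x, x \in S -> a * D <= (deg F x)%:R) ->
  (forall x, x \notin S -> (deg F x)%:R <= b * D) ->
  meet (ksub V k) S \subset F \/ F \subset meet (ksub V k) S.
Proof.
move=> opt k1 D0 rho1 mD cS small ab a4 hS hS'; have [sF _] := opt.
have kr0 : 0 < k%:R :> R by rewrite ltr0n ltnW.
have kr1 : 1 <= k%:R :> R by rewrite ler1n ltnW.
have rho0 : 0 < rho by apply: lt_le_trans rho1.
have p0 : 0 <= p by rewrite ler0n.
have q0 : 0 <= k%:R ^+ 2 * rho * p by rewrite !mulr_ge0 ?exprn_ge0 // ltW.
pose H := [set x | D / (4 * k%:R) <= (deg F x)%:R].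
have th0 : 0 < D / (4 * k%:R) by rewrite divr_gt0 // mulr_gt0.
have cH : #|H|%:R <= 8 * (k%:R * rho).
  have : #|H|%:R * (D / (4 * k%:R)) <= 2 * #|F|%:R.
    apply: (few_large sF k1) => //; first by move=> x; rewrite inE.
    rewrite -/p; have -> : 2 * (D / (4 * k%:R)) ^+ 2 = D ^+ 2 / (8 * k%:R ^+ 2).
      by field; rewrite gt_eqF.
    rewrite ler_pdivlMr ?mulr_gt0 ?exprn_gt0 //.
    have h1 := ler_wpM2r (mulr_ge0 p0 (exprn_ge0 2 (ltW kr0))) mD.
    have h2 := ler_wpM2r (ltW D0) small; have h3 := mulr_ge0 q0 (ltW D0).
    by move: h1 h2 h3; rewrite !expr2; clear; lra.
  move=> h; have := le_trans h (ler_wpM2l (ler0n R 2) mD).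
  have -> : 2 * (rho * D) = 8 * (k%:R * rho) * (D / (4 * k%:R)) by field; rewrite gt_eqF.
  by rewrite ler_pM2r.
apply: (@meet_dichotomy R T V k F S H D a b) => //; last 1 first.
- rewrite -/p natrD; apply: (@le_trans _ _ (k%:R * (9 * (k%:R * rho) * p))).
    rewrite ler_wpM2l ?(ltW kr0) // ler_wpM2r //.
    have : rho <= k%:R * rho by rewrite ler_peMl // ltW.
    by move: cS cH; clear; lra.
  have h1 := ler_wpM2r (ltW D0) a4; move: small h1 q0 D0; rewrite !expr2; clear; lra.
- by move=> x; rewrite inE -ltNge => /ltW.
- exact: ltW.
Qed.

(** The dichotomy is applied to [S] for delta <= 1/2 and to [v |: S] for delta > 1/2. In each case a
    size comparison settles which alternative holds, and the other inclusion uses the matching bound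
    on delta. *)
Lemma optimal_structure V k F S v (delta : R) (rho := (#|S| + 1)%N%:R : R) :
  optimal V k F -> (1 < k)%N -> S \subset V -> v \in V -> v \notin S ->
  (forall x, x \in S -> (deg F v <= deg F x)%N) ->
  (forall x, x \notin S -> (deg F x <= deg F v)%N) ->
  (3000 * 3000) * (rho ^+ 3 * (k + #|S|)%N%:R * k%:R ^+ 2) <= #|V|%:R ->
  #|F|%:R = #|meet (ksub V k) S|%:R + delta * ('C(#|V| - #|S| - 1, k - 1))%:R ->
  150 * k%:R ^+ 3 * rho ^+ 2 / #|V|%:R <= delta /\
    delta <= 1 - 150 * k%:R ^+ 3 * rho ^+ 3 / #|V|%:R \/ delta = 1 ->
  meet (ksub V k) S \subset F /\ F \subset meet (ksub V k) (v |: S).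
Proof.
move=> opt k1 sSV vV vS vmin vmax nbig cF hdelta; have [sF _] := opt; have k0 := ltnW k1.
have kr0 : 0 < k%:R :> R by rewrite ltr0n.
have kr2 : 2 <= k%:R :> R by rewrite ler_nat.
have rhoE : rho = #|S|%:R + 1 by rewrite /rho natrD.
have rho1 : 1 <= rho by rewrite rhoE lerDr.
have rho0 : 0 < rho by apply: lt_le_trans rho1.
have nkS : (k + #|S| <= #|V|)%N.
  rewrite -(ler_nat R); apply: le_trans nbig; set a : R := (k + #|S|)%N%:R.
  have a0 : 0 <= a by rewrite ler0n.
  have h : 1 <= rho ^+ 3 * k%:R ^+ 2.
    by apply: mulr_ege1; apply: exprn_ege1 => //; apply: le_trans kr2; rewrite ler1n.
  have h2 : a <= rho ^+ 3 * a * k%:R ^+ 2 by rewrite mulrAC ler_peMl.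
  apply: le_trans h2 _; rewrite ler_peMl ?mulr_ge0 ?exprn_ge0 ?(ltW rho0) ?(ltW kr0) //.
  by rewrite -natrM ler1n.
have n1 : (1 < #|V|)%N by apply: leq_trans nkS; rewrite (leq_trans k1) ?leq_addr.
have nr0 : 0 < #|V|%:R :> R by rewrite ltr0n ltnW.
have cS'E : #|v |: S| = (#|S| + 1)%N by rewrite cardsU1 vS addnC.
have sS'V : v |: S \subset V by rewrite subUset sub1set vV.
have SV : (#|S| < #|V|)%N by rewrite -addn1 -cS'E subset_leq_card.
have D0 : (0 < 'C(#|V| - 1, k - 1))%N.
  by rewrite bin_gt0 leq_sub2r // (leq_trans _ nkS) ?leq_addr.
have pnD := bin_codeg_le k1 n1.
have drop1 := bin_drop_le #|V| (#|S| + 1) k1.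
have NN' : ('C(#|V| - (#|S| + 1) - 1, k - 1) <= 'C(#|V| - #|S| - 1, k - 1))%N.
  by rewrite leq_bin2l // leq_sub2r // leq_sub2l // leq_addr.
have ND : ('C(#|V| - #|S| - 1, k - 1) <= 'C(#|V| - 1, k - 1))%N.
  by rewrite leq_bin2l // leq_sub2r // leq_subr.
have cLle := card_meet_le sSV k0.
have cL' := card_meetU1 sSV vV vS k0.
have profile := degree_profile opt k1 sSV vV vS vmin vmax _ _ cF _.
have smallp : (3000 * 3000) * (rho ^+ 3 * (k + #|S|)%N%:R * k%:R * ('C(#|V| - 2, k - 2))%:R)
    <= ('C(#|V| - 1, k - 1))%:R :> R.
  have := pnD; rewrite -(ler_nat R) !natrM => h.
  rewrite -(ler_pM2l kr0); apply: le_trans h; rewrite [X in _ <= X]mulrC.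
  apply: le_trans (ler_wpM2r (ler0n _ _) nbig); rewrite le_eqVlt; apply/orP; left.
  by apply/eqP; rewrite expr2; ring.
have {}profile := profile smallp.
rewrite ltr0n in profile; have {}profile := profile D0.
have rS : rho <= (k + #|S|)%N%:R by rewrite ler_nat addnC leq_add2r.
have kS : k%:R <= (k + #|S|)%N%:R :> R by rewrite ler_nat leq_addr.
set p : R := ('C(#|V| - 2, k - 2))%:R in smallp.
have p0 : 0 <= p by rewrite ler0n.
have small : 1000 * (k%:R ^+ 2 * rho * p) <= ('C(#|V| - 1, k - 1))%:R.
  apply: le_trans smallp; apply: ler_pM.
  - by [].
  - by rewrite !mulr_ge0 ?exprn_ge0 // ltW.
  - by rewrite -natrM ler_nat.
  - have h1 : 0 <= k%:R * rho * p * ((k + #|S|)%N%:R - k%:R).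
      by rewrite !mulr_ge0 ?(ltW rho0) ?(ltW kr0) // subr_ge0.
    have h2 : 0 <= k%:R * rho * p * (k + #|S|)%N%:R * (rho ^+ 2 - 1).
      rewrite !mulr_ge0 ?(ltW rho0) ?(ltW kr0) // subr_ge0; exact: exprn_ege1.
    by move: h1 h2; clear; lra.
clear smallp nbig.
set D : R := ('C(#|V| - 1, k - 1))%:R in profile small.
have D0r : 0 < D by rewrite ltr0n.
set N : R := ('C(#|V| - #|S| - 1, k - 1))%:R in cF profile.
have N0 : 0 <= N by rewrite ler0n.
have NDr : N <= D by rewrite ler_nat.
have pn : p * #|V|%:R <= k%:R * D by rewrite -!natrM ler_nat.
(* Removing r + 1 points costs at most rho p, a small fraction of D, so D, N and N' are nearly
   equal. *)
have Dhalf : D <= ('C(#|V| - (#|S| + 1) - 1, k - 1))%:R + D / 100.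
  have h : D <= ('C(#|V| - (#|S| + 1) - 1, k - 1))%:R + rho * p.
    by rewrite -natrM -natrD ler_nat.
  have h2 : 0 <= rho * p * (k%:R ^+ 2 - 1).
    rewrite !mulr_ge0 ?(ltW rho0) // subr_ge0; apply: exprn_ege1; apply: le_trans kr2.
    by rewrite ler1n.
  have h3 : 0 <= rho * p by rewrite mulr_ge0 // ltW.
  by move: h h2 h3 small D0r; clear; lra.
have NN'r : ('C(#|V| - (#|S| + 1) - 1, k - 1))%:R <= N by rewrite ler_nat.
have de01 : 0 <= delta <= 1.
  case: hdelta => [[h1 h2]|->]; last by rewrite ler01 lexx.
  have q (j : nat) : 0 <= 150 * k%:R ^+ 3 * rho ^+ j / #|V|%:R.
    by rewrite divr_ge0 ?mulr_ge0 ?exprn_ge0 // ltW.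
  apply/andP; split; first by apply: le_trans h1.
  by apply: le_trans h2 _; rewrite gerBl.
have [lo hi] := profile de01; case/andP: (de01) => de0 de1.
have mD : #|F|%:R <= rho * D.
  rewrite cF rhoE mulrDl mul1r lerD //; first by rewrite -natrM ler_nat.
  by apply: le_trans NDr; rewrite ler_piMl.
have LF : (#|meet (ksub V k) S| <= #|F|)%N.
  by rewrite -(ler_nat R) cF lerDl mulr_ge0.
have FL' : (#|F| <= #|meet (ksub V k) (v |: S)|)%N.
  by rewrite cL' -(ler_nat R) cF natrD lerD2l ler_piMl.
have LL' : meet (ksub V k) S \subset meet (ksub V k) (v |: S).
  apply/subsetP => A; rewrite !meetE => /andP[-> /set0Pn[x]]; rewrite inE => /andP[xA xS].
  by apply/set0Pn; exists x; rewrite !inE xA xS orbT.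
have [de|de] := lerP delta (1 / 2).
  have [h1 h2] := lo de.
  have sub : meet (ksub V k) S \subset F.
    (* The value 62/100 is 1/2 + 6/50, the profile bound on deg F v for delta <= 1/2. *)
    have [] := @meet_dichotomy_scaled V k F S D rho (9 / 10) (62 / 100) opt k1 D0r rho1 mD _ small.
    - by rewrite rhoE lerDl.
    - by clear; lra.
    - by clear; lra.
    - exact: h2.
    - move=> x xS; apply: (@le_trans _ _ (deg F v)%:R); first by rewrite ler_nat vmax.
      by apply: le_trans h1 _; rewrite ler_wpM2r ?(ltW D0r) //; move: de; clear; lra.
    - by [].
    - by move=> sub; have /eqP -> : F == meet (ksub V k) S by rewrite eqEcard sub.
  split=> //; set F' := F :\: meet (ksub V k) S.
  have opt' : optimal (V :\: S) k F' by apply: optimal_remove.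
  have cF' : #|F'|%:R = delta * N.
    by rewrite cardsDS // natrB // cF addrAC subrr add0r.
  have cVS : #|V :\: S| = (#|V| - #|S|)%N by rewrite cardsDS.
  have vmax' x : (deg F' x <= deg F' v)%N.
    have [/setDP[xV xS]|xVS] := boolP (x \in V :\: S).
      have := vmax x xS; rewrite (deg_remove sSV k0 sub xV xS) (deg_remove sSV k0 sub vV vS).
      by rewrite leq_add2l.
    by case: opt' => sF' _; rewrite (deg_notin sF' xVS).
  have inst : F' \subset meet (ksub (V :\: S) k) [set v].
    apply: (optimal_in_star R opt' k1) => //; rewrite ?inE ?vS ?cVS //.
      by rewrite -(ler_nat R) cF' ler_piMl.
    have [lt|le1] := ltnP 1 (#|V| - #|S|); last first.
      have -> : (#|V| - #|S| - 2 = 0)%N by move: le1; clear; lia.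
      have -> : 'C(0, k - 2) = (k == 2)%N by rewrite bin0n subn_eq0 eqn_leq k1 andbT.
      have le : (k <= #|V| - #|S|)%N by rewrite leq_subRL ?(ltnW SV) // addnC.
      by move: (leq_trans k1 le); rewrite ltnNge le1.
    have := bin_codeg_le k1 lt; rewrite -!(ler_nat R) !natrM.
    rewrite -/N natrB ?(ltnW SV) // => codeg.
    rewrite cF'; case: hdelta => [[hd _]|d1]; last by move: de; rewrite d1; clear; lra.
    set p' : R := ('C(#|V| - #|S| - 2, k - 2))%:R in codeg *.
    have p'0 : 0 <= p' by rewrite ler0n.
    (* Passing from |V| to |V| - |S| costs at most rho^2; thus the lower bound on delta gives 150
       k^2 p' <= delta N. *)
    have nS : #|V|%:R <= (#|V|%:R - #|S|%:R) * rho ^+ 2.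
      have : 0 <= (#|V|%:R - rho) * #|S|%:R.
        by rewrite mulr_ge0 // subr_ge0 /rho ler_nat addn1.
      have : 0 <= (#|V|%:R - #|S|%:R) * rho * #|S|%:R.
        by rewrite !mulr_ge0 ?(ltW rho0) // subr_ge0 ler_nat ltnW.
      by rewrite rhoE !expr2; clear; lra.
    apply: le_trans (ler_wpM2r N0 hd); rewrite [X in _ <= X]mulrAC ler_pdivlMr //.
    have h3 := ler_wpM2l (mulr_ge0 p'0 (exprn_ge0 2 (ltW kr0))) nS.
    have h4 := ler_wpM2r (mulr_ge0 (exprn_ge0 2 (ltW kr0)) (exprn_ge0 2 (ltW rho0))) codeg.
    by move: h3 h4; clear; lra.
  apply/subsetP => A AF; have [AL|AL] := boolP (A \in meet (ksub V k) S).
    exact: subsetP LL' _ AL.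
  have : A \in F' by rewrite inE AL.
  move=> /(subsetP inst); rewrite meet1 meetE (subsetP sF _ AF) => /andP[_ vA].
  by apply/set0Pn; exists v; rewrite !inE vA eqxx.
have [h1 h2] := hi (ltW de).
have sub : F \subset meet (ksub V k) (v |: S).
  (* The value 42/100 is 1/2 - 4/50, the profile bound on deg F v for delta > 1/2. *)
  have [] := @meet_dichotomy_scaled V k F (v |: S) D rho (42 / 100) (1 / 10) opt k1 D0r rho1 mD _ small.
  - by rewrite cS'E.
  - by clear; lra.
  - by clear; lra.
  - move=> x xS; apply: (@le_trans _ _ (deg F v)%:R).
      by apply: le_trans h1; rewrite ler_wpM2r ?(ltW D0r) //; move: de; clear; lra.
    by rewrite ler_nat; case/setU1P: xS => [->|/vmin].
  - exact: h2.
  - by move=> sub; have /eqP -> : meet (ksub V k) (v |: S) == F by rewrite eqEcard sub.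
  - by [].
split=> //; case: hdelta => [[_ hd]|d1]; last first.
  have /eqP -> // : F == meet (ksub V k) (v |: S).
  by rewrite eqEcard sub /= -(ler_nat R) cL' cF d1 mul1r natrD -/N lexx.
set P := meet (ksub V k) (v |: S) :\: F.
have cP : #|P|%:R = (1 - delta) * N.
  by rewrite /P cardsDS // natrB // cL' natrD cF -/N; ring.
have ND0 : D / 2 <= N by move: Dhalf NN'r D0r; clear; lra.
apply: (optimal_sup_meet (erefl P) opt k1 sSV vV vS sub vmin).
- rewrite -(ltr_nat R) cP -/N gtr_pMl ?gtrBl; move: de ND0 D0r; clear; lra.
- rewrite cS'E -(ler_nat R) cP natrM.
  have : 0 <= (delta - 1 / 2) * N by rewrite mulr_ge0 // subr_ge0 ltW.
  by move: ND0 Dhalf D0r NDr; clear; lra.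
(* Since p |V| <= k D <= 2 k N, the upper bound on delta makes |P| = (1 - delta) N at least 4 k rho
   p. *)
- rewrite cS'E -(ler_nat R) cP !natrM -/rho -/p.
  have h3 : 150 * k%:R ^+ 3 * rho ^+ 3 / #|V|%:R <= 1 - delta by move: hd; clear; lra.
  apply: le_trans (ler_wpM2r N0 h3); rewrite [X in _ <= X]mulrAC ler_pdivlMr //.
  have h4 := ler_wpM2l (mulr_ge0 (ltW kr0) (ltW rho0)) pn.
  have h5 : 0 <= k%:R ^+ 2 * rho * (N - D / 2).
    by rewrite !mulr_ge0 ?exprn_ge0 ?(ltW rho0) ?(ltW kr0) // subr_ge0.
  have h6 : 0 <= k%:R ^+ 2 * rho * N * (k%:R - 1).
    by rewrite !mulr_ge0 ?exprn_ge0 ?(ltW rho0) ?(ltW kr0) // subr_ge0 ler1n.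
  have h7 : 0 <= k%:R ^+ 3 * rho * N * (rho ^+ 2 - 1).
    rewrite !mulr_ge0 ?exprn_ge0 ?(ltW rho0) ?(ltW kr0) // subr_ge0; exact: exprn_ege1.
  have h8 : 0 <= k%:R ^+ 2 * rho * N by rewrite !mulr_ge0 ?exprn_ge0 ?(ltW rho0) ?(ltW kr0).
  by move: h4 h5 h6 h7 h8; clear; lra.
Qed.

End Profile.

(** * Lexicographic families and relabelling *)

Section Lex.
Local Open Scope nat_scope.
Variable n : nat.
Implicit Types (F : {set {set 'I_n}}) (A B : {set 'I_n}).

Lemma ksetsE k : ksets n k = ksub [set: 'I_n] k.
Proof. by apply/setP => A; rewrite !inE subsetT. Qed.

Lemma total_interE F : total_inter F = inter F.
Proof.
rewrite inter_wt; apply: eq_bigr => A _; rewrite /wt sum_deg_on.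
by apply: eq_bigr => B _; rewrite setIC.
Qed.

Lemma max_total_inter_optimal k F : F \subset ksets n k ->
  total_inter F = max_total_inter k F -> optimal [set: 'I_n] k F.
Proof.
move=> sF eF; split=> [|G sG cG]; first by rewrite -ksetsE.
rewrite -!total_interE eF /max_total_inter.
apply: (@leq_bigmax_cond _ (fun G : {set {set 'I_n}} => (G \subset ksets n k) && (#|G| == #|F|))).
by rewrite ksetsE sG cG eqxx.
Qed.

Definition first_ords (r : nat) : {set 'I_n} := [set i : 'I_n | i < r].

Lemma card_first_ords r : r <= n -> #|first_ords r| = r.
Proof.
move=> rn; have -> : first_ords r = [set widen_ord rn i | i in 'I_r].
  apply/setP => i; rewrite inE; apply/idP/imsetP => [ir|[j _ ->]]; last exact: (ltn_ord j).
  by exists (Ordinal ir) => //; apply: val_inj.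
rewrite card_imset ?card_ord // => i j /(congr1 val) /= e; exact: val_inj.
Qed.

Lemma lex_lt_irrefl A : lex_lt A A = false.
Proof. by apply/existsP => -[x /and3P[-> ]]. Qed.

Lemma lex_lt_first A B r : lex_lt B A -> A :&: first_ords r != set0 ->
  B :&: first_ords r != set0.
Proof.
case/existsP=> x /and3P[xB _ /forallP h] /set0Pn[y]; rewrite !inE => /andP[yA yr].
apply/set0Pn; have [xr|rx] := ltnP x r; first by exists x; rewrite !inE xB.
exists y; rewrite !inE yr andbT.
by have := h y; rewrite (leq_trans yr rx) /= => /eqP ->.
Qed.

Lemma first_lex_lt A B r : A :&: first_ords r == set0 -> B :&: first_ords r != set0 ->
  lex_lt B A.
Proof.
move=> /eqP Ar /set0Pn[y]; rewrite !inE => /andP[yB yr].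
have nA (z : 'I_n) : z < r -> z \notin A.
  by move=> zr; apply/negP => zA; have := in_set0 z; rewrite -Ar !inE zA zr.
case: (@arg_minnP _ y (mem B) (fun z : 'I_n => val z) yB) => x xB xmin.
have xr : x < r := leq_ltn_trans (xmin y yB) yr.
apply/existsP; exists x; rewrite [x \in B]xB (nA x xr) /=; apply/forallP => z; apply/implyP => zx.
rewrite (negbTE (nA z (ltn_trans zx xr))); apply/eqP/negP => zB.
by have := xmin z zB; rewrite leqNgt zx.
Qed.

(** Sets hitting the first r points precede all others, and for t = 1 the size in [Lex] is C(n, k) -
    C(n - r, k), their number. *)
Lemma LexE k r : 0 < k -> 0 < n -> r <= n ->
  Lex n k 1 r = meet (ksub [set: 'I_n] k) (first_ords r).
Proof.
move=> k0 n0 rn; rewrite /Lex /lex_initial ksetsE; set m := _ - _; set L := meet _ _.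
have cL : #|L| = m.
  have := card_meet k (subsetT (first_ords r)); rewrite -/L cardsT card_ord card_first_ords //.
  by rewrite /m !subnK // [1 + r]addnC addnK => <-; rewrite addnK.
apply/setP => A; rewrite [LHS]in_set [RHS]meetE; case: (boolP (A \in ksub _ _)) => //= AV.
apply/idP/idP => [|Ar].
  apply: contraTT; rewrite negbK -leqNgt -cL => Ar; apply: subset_leq_card.
  apply/subsetP => B; rewrite meetE => /andP[BV Br]; rewrite in_set BV.
  exact: first_lex_lt Ar Br.
(* The predecessors of a set in [L] all lie in [L] and exclude the set itself, so their number is
   strictly below m. *)
rewrite -cL; apply: proper_card; apply/properP; split.
  apply/subsetP => B; rewrite in_set => /andP[BV BA].
  by rewrite meetE BV (lex_lt_first BA Ar).
by exists A; rewrite ?meetE ?AV ?Ar // in_set lex_lt_irrefl andbF.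
Qed.

Lemma sorting_perm (f : 'I_n -> nat) :
  exists s : {perm 'I_n}, forall i j : 'I_n, i <= j -> f (s j) <= f (s i).
Proof.
pose leT x y := f y <= f x.
have tot : total leT by move=> x y; apply: leq_total.
have tr : transitive leT by move=> y x z /= h1 h2; apply: leq_trans h2 h1.
have sz : size (sort leT (enum 'I_n)) == n by rewrite size_sort size_enum_ord.
pose t := Tuple sz.
have inj : injective (tnth t).
  by apply/tuple_uniqP; rewrite /= sort_uniq enum_uniq.
exists (perm inj) => i j ij; rewrite !permE.
have x0 := i; rewrite !(tnth_nth x0).
apply: (sorted_leq_nth tr (fun x => leqnn (f x)) x0 (sort_sorted tot _)) => //.
  by rewrite inE (eqP sz).
by rewrite inE (eqP sz).
Qed.

(** Iterated Pascal's rule; it turns the sum in the size condition into the number of k-sets hitting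
    r given points. *)
Lemma sum_bin k r : 0 < k -> r <= n ->
  \sum_(1 <= i < r.+1) 'C(n - i, k - 1) + 'C(n - r, k) = 'C(n, k).
Proof.
move=> k0; elim: r => [|r IH] rn; first by rewrite big_geq // subn0.
rewrite big_nat_recr //= -IH; last exact: ltnW.
rewrite -addnA; congr (_ + _).
have -> : n - r = (n - r.+1).+1 by lia.
by case: k k0 {IH} => // k _; rewrite subSS subn0 binS addnC.
Qed.

End Lex.

(** * Action of permutations and the final relabelling *)

Lemma imset_permK n (s : {perm 'I_n}) (A : {set 'I_n}) :
  [set s^-1%g x | x in [set s x | x in A]] = A.
Proof.
by rewrite -imset_comp (eq_imset _ (permK s)) imset_id.
Qed.

Lemma mem_perm_family n (s : {perm 'I_n}) (F : {set {set 'I_n}}) A :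
  (A \in perm_family s^-1%g F) = ([set s x | x in A] \in F).
Proof.
apply/imsetP/idP => [[B BF ->]|AF].
  by have := imset_permK s^-1%g B; rewrite invgK => ->.
by exists [set s x | x in A]; rewrite ?imset_permK.
Qed.

Lemma meet_perm n (s : {perm 'I_n}) k (S A : {set 'I_n}) :
  ([set s x | x in A] \in meet (ksub [set: 'I_n] k) [set s x | x in S])
  = (A \in meet (ksub [set: 'I_n] k) S).
Proof.
rewrite !meetE !inE !subsetT card_imset; last exact: perm_inj.
by rewrite -imsetI ?imset_eq0 // => x y _ _; apply: perm_inj.
Qed.

Theorem theorem1p2 (R : realType) :
  exists C0 : R, 3000%:R <= C0 /\
  forall (k r n : nat) (delta : R) (F : {set {set 'I_n}}),
    (2 <= k)%N ->
    C0 * ((r + 1) ^ 3 * (k + r) * k ^ 2)%:R <= n%:R ->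
    ((150 * k ^ 3 * (r + 1) ^ 2)%:R / n%:R <= delta /\
       delta <= 1 - (150 * k ^ 3 * (r + 1) ^ 3)%:R / n%:R
     \/ delta = 1) ->
    F \subset ksets n k ->
    (#|F|)%:R = (\sum_(1 <= i < r.+1) 'C(n - i, k - 1))%:R
                + delta * ('C(n - (r + 1), k - 1))%:R ->
    total_inter F = max_total_inter k F ->
    exists s : {perm 'I_n},
      Lex n k 1 r \subset perm_family s F /\ perm_family s F \subset Lex n k 1 (r + 1).
Proof.
(* The constant is the factor in the size hypothesis of [optimal_structure]. *)
exists (3000%:R * 3000%:R); split; first by rewrite ler_pMr ?ltr0n // ler1n.
move=> k r n delta F k2 nbig hdelta sF cF eF.
have an : ((r + 1) ^ 3 * (k + r) * k ^ 2 <= n)%N.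
  rewrite -(ler_nat R); apply: le_trans nbig; rewrite ler_peMl //.
  by rewrite -natrM ler1n muln_gt0.
have rn : (r < n)%N.
  have h : (r + 1 <= (r + 1) ^ 3)%N by rewrite -{1}[(r + 1)%N]expn1 leq_pexp2l ?addn1.
  apply: leq_trans an; rewrite -addn1 -mulnA; apply: leq_trans h _.
  by rewrite leq_pmulr // muln_gt0 addn_gt0 expn_gt0 (ltnW k2).
have n0 : (0 < n)%N by apply: leq_ltn_trans rn.
have [s sP] := sorting_perm (deg F).
have optF := max_total_inter_optimal sF eF.
(* As [s] lists the points by decreasing degree, [S] receives the r largest degrees and [v] the next
   one. *)
pose v := s (Ordinal rn); pose S := [set s x | x in first_ords n r].
have memS i : (s i \in S) = (i < r)%N by rewrite mem_imset ?inE //; apply: perm_inj.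
have cS : #|S| = r by rewrite card_imset ?card_first_ords 1?ltnW //; apply: perm_inj.
have vSE : v |: S = [set s x | x in first_ords n (r + 1)].
  apply/setP => y; rewrite -[y](permKV s); move: (s^-1%g y) => i.
  rewrite in_setU1 memS mem_imset; last exact: perm_inj.
  rewrite [RHS]in_set /v.
  by rewrite (inj_eq perm_inj) -val_eqE /= addn1 ltnS [RHS]leq_eqVlt.
have powE (j : nat) : (150 * k ^ 3 * (r + 1) ^ j)%:R
    = 150%:R * k%:R ^+ 3 * (r + 1)%:R ^+ j :> R by rewrite -!natrX -!natrM.
have [] := @optimal_structure R _ [set: 'I_n] k F S v delta optF k2.
- exact: subsetT.
- by [].
- by rewrite memS ltnn.
- by move=> x; rewrite -[x](permKV s) memS => /ltnW ix; apply: sP.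
- by move=> x; rewrite -[x](permKV s) memS -leqNgt => rx; apply: sP.
- by rewrite cS cardsT card_ord -!natrX -!natrM; apply: le_trans nbig; rewrite !natrM.
- have := card_meet k (subsetT S); rewrite cS cardsT card_ord.
  rewrite -(sum_bin (ltnW k2) (ltnW rn)) => /addIn ->.
  by rewrite cF subnDA.
- by rewrite cS cardsT card_ord -!powE.
move=> sub sup.
(* The inverse is taken because [s] sends the first r points onto [S]. *)
exists s^-1%g.
rewrite !LexE ?addn1 ?(ltnW k2) ?(ltnW rn) //.
split; apply/subsetP => A; rewrite mem_perm_family.
  by rewrite -(meet_perm s) => /(subsetP sub).
by move=> /(subsetP sup); rewrite vSE meet_perm addn1.
Qed.
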